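(* Let $n\in\mathbb{N}$, let $\Gamma$ be a group of type $\mathrm{FP}_{n+1}$, and let $\alpha$ be a standard $\Gamma$-action. Then $$b^{(2)}_n(\Gamma)\le\mathrm{medim}^{\mathbb{Z}}_n(\alpha),$$ where $b^{(2)}_n(\Gamma)$ denotes the $n$-th $L^2$-Betti number of $\Gamma$.
   Context: $\mathbb{N}$ contains $0$. A group $\Gamma$ is of type $\mathrm{FP}_m$ if the trivial $\mathbb{Z}\Gamma$-module $\mathbb{Z}$ has a projective resolution that is finitely generated in degrees $\le m$. A standard $\Gamma$-action $\alpha\colon\Gamma\curvearrowright(X,\mu)$ is an essentially free, probability measure preserving action of a countable group on a standard Borel probability space. $L^\infty(\alpha,\mathbb{Z})=L^\infty(X,\mu,\mathbb{Z})$ is the ring of essentially bounded measurable functions $X\to \mathbb{Z}$ modulo a.e. equality, with $(\gamma\cdot\lambda)(x)=\lambda(\gamma^{-1}x)$. The crossed product ring $R=L^\infty(\alpha,\mathbb{Z})*\Gamma$ is the free $L^\infty(\alpha,\mathbb{Z})$-module with basis $\Gamma$ (elements are finite sums of terms $(\lambda,\gamma)$) with multiplication $(\lambda,\gamma)(\lambda',\gamma')=(\lambda\cdot(\gamma\cdot\lambda'),\gamma\gamma')$. It contains $\mathbb{Z}\Gamma$ via $\gamma\mapsto(1,\gamma)$ and acts on $L^\infty(\alpha,\mathbb{Z})$ by $(\lambda,\gamma)\cdot f=\lambda\cdot(\gamma\cdot f)$. For measurable $A\subset X$ put $\langle A\rangle=R\cdot(\chi_A,1)$. A marked projective $R$-module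 is an $R$-module $M$ with a finite family $(A_i)_{i\in I}$ of measurable subsets of $X$ and an isomorphism $M\cong\bigoplus_{i\in I}\langle A_i\rangle$; $\dim_R(M)=\sum_i\mu(A_i)$. A marked projective augmented $R$-chain complex $D_*\twoheadrightarrow L^\infty(\alpha,\mathbb{Z})$ is a chain complex $(D_k)_{k\ge0}$ of marked projective $R$-modules with a surjective $R$-homomorphism $\eta\colon D_0\to L^\infty(\alpha,\mathbb{Z})$, $\eta\circ\partial_1=0$. Fix a free $\mathbb{Z}\Gamma$-resolution $C_*\twoheadrightarrow \mathbb{Z}$ (the following is independent of the choice). An $\alpha$-embedding (up to degree $n$) is such a complex together with a $\mathbb{Z}\Gamma$-chain map $C_*\to D_*$ up to degree $n+1$ extending the inclusion $\mathbb{Z}\to L^\infty(\alpha,\mathbb{Z})$ as constant functions. $A_n(\alpha)$ is the class of all augmented complexes $D_*$ arising in this way, and $\mathrm{medim}^{\mathbb{Z}}_n(\alpha)=\inf_{D_*\in A_n(\alpha)}\dim_R(D_n)$. *)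

(* Defs.v *)
From HB Require Import structures.
From mathcomp Require Import all_boot all_order all_algebra.
From mathcomp Require Import finmap.
From mathcomp Require Import all_classical all_reals all_analysis.
From mathcomp Require Import complex.
From mathcomp Require Import -(notations) monalg.

Set Implicit Arguments.
Unset Strict Implicit.
Unset Printing Implicit Defensive.

Import Order.TTheory GRing.Theory Num.Theory.

Local Open Scope classical_set_scope.
Local Open Scope ring_scope.

Record gring (G : groupType) := GRingAct {
  gring_sort :> comNzRingType;
  gact : G -> gring_sort -> gring_sort;
  gact_one : forall a, gact 1%g a = a;
  gact_mul : forall g h a, gact (g * h)%g a = gact g (gact h a);
  gactD : forall g a b, gact g (a + b) = gact g a + gact g b;
  gactM : forall g a b, gact g (a * b) = gact g a * gact g b
}.

Section GringTheory.
Context {G : groupType} (A : gring G).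

Lemma gact0 g : gact g (0 : A) = 0.
Proof. by apply: (addrI (gact g (0 : A))); rewrite -gactD !addr0. Qed.

Lemma gactN g (a : A) : gact g (- a) = - gact g a.
Proof. by apply: (addrI (gact g a)); rewrite -gactD !subrr gact0. Qed.

Lemma gactB g : zmod_morphism (@gact _ A g).
Proof. by move=> a b; rewrite gactD gactN. Qed.

Lemma gact1 g : gact g (1 : A) = 1.
Proof.
rewrite -[LHS]mul1r -[X in X * _](gact_one (1 : A)) -(mulgV g) gact_mul.
by rewrite -gactM mulr1 -gact_mul mulgV gact_one.
Qed.

HB.instance Definition _ g :=
  GRing.isZmodMorphism.Build A A (@gact _ A g) (gactB g).

End GringTheory.

(* Finitely supported functions G -> A; mkmalgU g a is the term (a, g). *)
Definition crossed (G : groupType) (A : gring G) : Type := malg G A.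

HB.instance Definition _ (G : groupType) (A : gring G) :=
  GRing.Zmodule.on (crossed A).

Section Extension.
Context {K : choiceType} {A V : zmodType} (F : K -> {additive A -> V}).

Definition malg_ext (x : malg K A) : V := \sum_(k <- msupp x) F k (mcoeff k x).

Lemma malg_extw (d : {fset K}) x : (msupp x `<=` d)%fset ->
  malg_ext x = \sum_(k <- d) F k (mcoeff k x).
Proof.
move=> le; rewrite /malg_ext (big_fset_incl _ le)// => k _ knx.
by rewrite mcoeff_outdom// raddf0.
Qed.

Lemma malg_ext_additive : zmod_morphism malg_ext.
Proof.
move=> x y; pose d := (msupp x `|` msupp y)%fset.
rewrite (@malg_extw d) ?msuppB_le// (@malg_extw d x) ?fsubsetUl//.
rewrite (@malg_extw d y) ?fsubsetUr// -sumrB.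
by apply: eq_bigr => k _; rewrite mcoeffB raddfB.
Qed.

HB.instance Definition _ :=
  GRing.isZmodMorphism.Build (malg K A) V malg_ext malg_ext_additive.

Lemma malg_extU k a : malg_ext (mkmalgU k a) = F k a.
Proof.
rewrite /malg_ext msuppU; case: eqP => [->|_].
  by rewrite big_seq_fset0 raddf0.
by rewrite big_seq_fset1 mcoeffUU.
Qed.

End Extension.

Section Crossed.
Context {G : groupType} (A : gring G).
Local Notation R := (crossed A).
Implicit Types (x y z : R) (g h : G) (a b : A).

Definition crossed_one : R := mkmalgU 1%g (1 : A).

(* (a, g) (b, h) = (a * (g . b), g h) *)
Definition crossed_mul x y : R :=
  \sum_(g <- msupp x) \sum_(h <- msupp y)
     mkmalgU (g * h)%g (mcoeff g x * gact g (mcoeff h y)).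

(* (a, g) . f = a * (g . f) *)
Definition crossed_act x (f : A) : A :=
  \sum_(g <- msupp x) mcoeff g x * gact g f.

Lemma crossed_ind (P : R -> Prop) :
  (forall g a, P (mkmalgU g a)) -> (forall x y, P x -> P y -> P (x + y)) ->
  forall x, P x.
Proof.
move=> PU PD x; rewrite (monalgE x : x = _).
elim/big_ind : _ => //; first by rewrite -(monalgU0 1%g); exact: PU.
Qed.

Definition lmulF y g a : R :=
  \sum_(h <- msupp y) mkmalgU (g * h)%g (a * gact g (mcoeff h y)).
Lemma lmulF_additive y g : zmod_morphism (lmulF y g).
Proof.
by move=> a b; rewrite /lmulF -sumrB; apply: eq_bigr => h _;
  rewrite mulrBl monalgUB.
Qed.
HB.instance Definition _ y g :=
  GRing.isZmodMorphism.Build A R (lmulF y g) (lmulF_additive y g).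

Definition rmulF x h b : R :=
  \sum_(g <- msupp x) mkmalgU (g * h)%g (mcoeff g x * gact g b).
Lemma rmulF_additive x h : zmod_morphism (rmulF x h).
Proof.
by move=> a b; rewrite /rmulF -sumrB; apply: eq_bigr => g _;
  rewrite raddfB mulrBr monalgUB.
Qed.
HB.instance Definition _ x h :=
  GRing.isZmodMorphism.Build A R (rmulF x h) (rmulF_additive x h).

Lemma crossed_mulEl x y : crossed_mul x y = malg_ext (lmulF y) x.
Proof. by []. Qed.

Lemma crossed_mulEr x y : crossed_mul x y = malg_ext (rmulF x) y.
Proof. by rewrite /crossed_mul exchange_big. Qed.

Lemma crossed_mulDl : left_distributive crossed_mul +%R.
Proof. by move=> x y z; rewrite !crossed_mulEl raddfD. Qed.

Lemma crossed_mulDr : right_distributive crossed_mul +%R.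
Proof. by move=> x y z; rewrite !crossed_mulEr raddfD. Qed.

Lemma crossed_mulU g h a b :
  crossed_mul (mkmalgU g a) (mkmalgU h b) = mkmalgU (g * h)%g (a * gact g b).
Proof.
rewrite crossed_mulEl malg_extU /= /lmulF msuppU; case: eqP => [->|_].
  by rewrite big_seq_fset0 gact0 mulr0 monalgU0.
by rewrite big_seq_fset1 mcoeffUU.
Qed.

Lemma crossed_mulA : associative crossed_mul.
Proof.
elim/crossed_ind => [g a|x x' IHx IHx'] y z; last first.
  by rewrite !crossed_mulDl IHx IHx'.
elim/crossed_ind: y => [h b|y y' IHy IHy']; last first.
  by rewrite !(crossed_mulDl, crossed_mulDr) IHy IHy'.
elim/crossed_ind: z => [k c|z z' IHz IHz']; last first.
  by rewrite !crossed_mulDr IHz IHz'.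
by rewrite !crossed_mulU gactM gact_mul mulrA mulgA.
Qed.

Lemma crossed_mul1r : left_id crossed_one crossed_mul.
Proof.
elim/crossed_ind => [h b|y y' IHy IHy']; last by rewrite crossed_mulDr IHy IHy'.
by rewrite crossed_mulU mul1g mul1r gact_one.
Qed.

Lemma crossed_mulr1 : right_id crossed_one crossed_mul.
Proof.
elim/crossed_ind => [h b|y y' IHy IHy']; last by rewrite crossed_mulDl IHy IHy'.
by rewrite crossed_mulU mulg1 gact1 mulr1.
Qed.

Lemma crossed_one_neq0 : crossed_one != 0.
Proof. by rewrite monalgU_eq0 oner_neq0. Qed.

HB.instance Definition _ := GRing.Zmodule_isNzRing.Build (crossed A)
  crossed_mulA crossed_mul1r crossed_mulr1 crossed_mulDl crossed_mulDr
  crossed_one_neq0.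

Definition actF (f : A) g a : A := a * gact g f.
Lemma actF_additive f g : zmod_morphism (actF f g).
Proof. by move=> a b; rewrite /actF mulrBl. Qed.
HB.instance Definition _ f g :=
  GRing.isZmodMorphism.Build A A (actF f g) (actF_additive f g).

Lemma crossed_actE x f : crossed_act x f = malg_ext (actF f) x.
Proof. by []. Qed.

Lemma crossed_actU g a f : crossed_act (mkmalgU g a) f = a * gact g f.
Proof. by rewrite crossed_actE malg_extU. Qed.

Lemma crossed_actDl f x y :
  crossed_act (x + y) f = crossed_act x f + crossed_act y f.
Proof. by rewrite !crossed_actE raddfD. Qed.

Lemma crossed_actDr : right_distributive crossed_act +%R.
Proof.
move=> x f f'; rewrite /crossed_act -big_split /=.
by apply: eq_bigr => g _; rewrite gactD mulrDr.
Qed.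

Lemma crossed_actA x y f :
  crossed_act x (crossed_act y f) = crossed_act (x * y) f.
Proof.
elim/crossed_ind: x => [g a|x x' IHx IHx']; last first.
  by rewrite mulrDl !crossed_actDl IHx IHx'.
elim/crossed_ind: y => [h b|y y' IHy IHy']; last first.
  by rewrite mulrDr !crossed_actDl crossed_actDr IHy IHy'.
rewrite [_ * _]crossed_mulU !crossed_actU gactM gact_mul.
by rewrite mulrA.
Qed.

Lemma crossed_act1 f : crossed_act 1 f = f.
Proof. by rewrite (_ : 1 = crossed_one)// crossed_actU gact_one mul1r. Qed.

End Crossed.

Definition base_mod (G : groupType) (A : gring G) : Type := A.
HB.instance Definition _ (G : groupType) (A : gring G) :=
  GRing.Zmodule.on (base_mod A).
HB.instance Definition _ (G : groupType) (A : gring G) :=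
  GRing.Zmodule_isLmodule.Build (crossed A) (base_mod A)
    (@crossed_actA G A) (@crossed_act1 G A) (@crossed_actDr G A)
    (@crossed_actDl G A).

Definition int_gring (G : groupType) : gring G :=
  @GRingAct G int (fun=> id) (fun=> erefl) (fun _ _ _ => erefl)
    (fun _ _ _ => erefl) (fun _ _ _ => erefl).

(* The crossed product of Z with the trivial action is the group ring Z[G], and
   its coefficient module is the trivial Z[G]-module Z. *)
Definition ZG (G : groupType) : nzRingType := crossed (int_gring G).
Definition Ztriv (G : groupType) : lmodType (ZG G) := base_mod (int_gring G).

Section Inclusion.
Context {G : groupType} (A : gring G).

Definition inclF (g : G) (n : int) : crossed A := mkmalgU g (n%:~R : A).
Lemma inclF_additive g : zmod_morphism (inclF g).
Proof. by move=> m n; rewrite /inclF rmorphB /= monalgUB. Qed.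
HB.instance Definition _ g :=
  GRing.isZmodMorphism.Build int (crossed A) (inclF g) (inclF_additive g).

Definition ZG_incl (x : ZG G) : crossed A :=
  \sum_(g <- msupp x) mkmalgU g ((mcoeff g x)%:~R : A).

Lemma ZG_inclE x : ZG_incl x = malg_ext inclF x.
Proof. by []. Qed.

Lemma ZG_inclB : zmod_morphism ZG_incl.
Proof. by move=> x y; rewrite !ZG_inclE raddfB. Qed.
HB.instance Definition _ :=
  GRing.isZmodMorphism.Build (ZG G) (crossed A) ZG_incl ZG_inclB.

Lemma ZG_inclU g (n : int) : ZG_incl (mkmalgU g n) = mkmalgU g (n%:~R : A).
Proof. by rewrite ZG_inclE malg_extU. Qed.

Lemma gact_int g (n : int) : gact g (n%:~R : A) = n%:~R.
Proof. by rewrite raddfMz /= gact1. Qed.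

Lemma ZG_incl_monoid : monoid_morphism ZG_incl.
Proof.
split; first exact: (ZG_inclU 1%g 1).
move=> x y; elim/(@crossed_ind G (int_gring G)): x => [g a|x x' IHx IHx'].
  elim/(@crossed_ind G (int_gring G)): y => [h b|y y' IHy IHy'].
    rewrite [in LHS]/GRing.mul /= crossed_mulU /= !ZG_inclU.
    by rewrite [RHS]crossed_mulU gact_int intrM.
  by rewrite mulrDr !raddfD /= IHy IHy' mulrDr.
by rewrite mulrDl !raddfD /= IHx IHx' mulrDl.
Qed.
HB.instance Definition _ :=
  GRing.isMonoidMorphism.Build (ZG G) (crossed A) ZG_incl ZG_incl_monoid.

End Inclusion.

Section EssBounded.
Context {R : realType} {d : measure_display} {X : measurableType d}.
Variable mu : probability X R.

(* Z carries the discrete sigma-algebra. *)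
Definition int_measurable (f : X -> int) : Prop :=
  forall B : set int, measurable (f @^-1` B).

Definition ess_bounded (f : X -> int) : Prop :=
  exists M : int, {ae mu, forall x, `|f x| <= M}.

Definition Lmeas : {pred X -> int} :=
  [pred f | `[< int_measurable f /\ ess_bounded f >]].

Lemma LmeasP f : reflect (int_measurable f /\ ess_bounded f) (f \in Lmeas).
Proof. exact: asboolP. Qed.

Lemma int_measurable2 (op : int -> int -> int) f g :
  int_measurable f -> int_measurable g ->
  int_measurable (fun x => op (f x) (g x)).
Proof.
move=> mf mg B.
rewrite (_ : _ @^-1` B = \bigcup_(a in [set: int])
    (f @^-1` [set a] `&` g @^-1` [set b | B (op a b)])); last first.
  apply/seteqP; split => x /=; first by move=> Bx; exists (f x).
  by case=> a _ [/= <-].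
by apply: countable_bigcupT_measurable => // a; exact: measurableI.
Qed.

Lemma Lmeas_subring : subring_closed Lmeas.
Proof.
split=> [|f g /LmeasP[mf [M fM]] /LmeasP[mg [N gN]]
         |f g /LmeasP[mf [M fM]] /LmeasP[mg [N gN]]]; apply/LmeasP; split.
- move=> B; have [B1|nB1] := pselect (B 1).
    by rewrite (_ : _ @^-1` B = setT)//; apply/seteqP; split.
  by rewrite (_ : _ @^-1` B = set0)//; apply/seteqP; split.
- by exists 1; apply: aeW => x; rewrite /= normr1.
- exact: (int_measurable2 (fun a b => a - b)).
- exists (M + N); move: fM gN; apply: filterS2 => x fM gN.
  by rewrite (le_trans (ler_normB _ _))// lerD.
- exact: (int_measurable2 (fun a b => a * b)).
- exists (M * N); move: fM gN; apply: filterS2 => x fM gN.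
  by rewrite normrM ler_pM.
Qed.

HB.instance Definition _ :=
  GRing.isSubringClosed.Build (X -> int) Lmeas Lmeas_subring.

Definition ess_bounded_fun : Type := {f : X -> int | f \in Lmeas}.
HB.instance Definition _ := SubChoice.on ess_bounded_fun.
HB.instance Definition _ :=
  [SubChoice_isSubComNzRing of ess_bounded_fun by <:].

Definition ae_zero : {pred ess_bounded_fun} :=
  [pred f | `[< {ae mu, forall x, val f x = 0} >]].

Lemma ae_zeroP f : reflect {ae mu, forall x, val f x = 0} (f \in ae_zero).
Proof. exact: asboolP. Qed.

Lemma ae_zero_ideal : idealr_closed ae_zero.
Proof.
split.
- by apply/ae_zeroP; apply: aeW.
- apply/negP => /ae_zeroP H.
  have PF : ProperFilter (almost_everywhere mu).
    apply: ae_properfilter_algebraOfSetsType.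
    suff : (0 < mu [set: X])%E by [].
    by rewrite probability_setT lte01.
  by have [x /eqP] := filter_ex H; rewrite oner_eq0.
- move=> a f g /ae_zeroP f0 /ae_zeroP g0; apply/ae_zeroP.
  move: f0 g0; apply: filterS2 => x /= f0 g0.
  by rewrite /GRing.add /= /GRing.mul /= f0 g0 mulr0 addr0.
Qed.

HB.instance Definition _ := isIdealr.Build ess_bounded_fun ae_zero ae_zero_ideal.

Definition Linf : comNzRingType := {ideal_quot ae_zero}.

End EssBounded.

Section LinfOf.
Context {R : realType} {d : measure_display} {X : measurableType d}.
Variable mu : probability X R.
Local Open Scope quotient_scope.

(* The class of f (0 if f is not measurable or not essentially bounded). *)
Definition Linf_of (f : X -> int) : Linf mu :=
  \pi_({ideal_quot (@ae_zero R d X mu)}) (insubd (0 : ess_bounded_fun mu) f).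

Definition Linf_rep (a : Linf mu) : X -> int :=
  val (repr (a : {ideal_quot (@ae_zero R d X mu)})).

Lemma Linf_repP a : Linf_rep a \in Lmeas mu.
Proof. exact: valP. Qed.

Lemma Linf_repK a : Linf_of (Linf_rep a) = a.
Proof. by rewrite /Linf_of /Linf_rep valKd reprK. Qed.

Lemma Linf_of_eq f g : f \in Lmeas mu -> g \in Lmeas mu ->
  {ae mu, forall x, f x = g x} -> Linf_of f = Linf_of g.
Proof.
move=> Lf Lg fg; apply/eqP; rewrite -[_ == _]Quotient.idealrBE.
apply/ae_zeroP; move: fg; apply: filterS => x fg.
by rewrite raddfB /= !insubdK//; apply/eqP; rewrite subr_eq0 fg.
Qed.

Lemma Linf_of_ae f g : f \in Lmeas mu -> g \in Lmeas mu ->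
  Linf_of f = Linf_of g -> {ae mu, forall x, f x = g x}.
Proof.
move=> Lf Lg /eqP; rewrite -[_ == _]Quotient.idealrBE => /ae_zeroP.
apply: filterS => x; rewrite raddfB /= !insubdK// => /eqP.
by rewrite subr_eq0 => /eqP.
Qed.

Lemma Linf_ofD f g : f \in Lmeas mu -> g \in Lmeas mu ->
  Linf_of (f + g) = Linf_of f + Linf_of g.
Proof.
move=> Lf Lg; rewrite /Linf_of -[RHS]raddfD; congr (\pi _).
by apply: val_inj; rewrite raddfD /= !insubdK// rpredD.
Qed.

Lemma Linf_ofM f g : f \in Lmeas mu -> g \in Lmeas mu ->
  Linf_of (f * g) = Linf_of f * Linf_of g.
Proof.
move=> Lf Lg; rewrite /Linf_of -[RHS]rmorphM; congr (\pi _).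
by apply: val_inj; rewrite rmorphM /= !insubdK// rpredM.
Qed.

Lemma Linf_of1 : Linf_of 1 = 1.
Proof.
rewrite /Linf_of -[RHS](rmorph1 (\pi_{ideal_quot (@ae_zero R d X mu)})).
by congr (\pi _); apply: val_inj; rewrite insubdK ?rpred1.
Qed.

Definition Linf_chi (A : set X) : Linf mu := Linf_of (\1_A).

End LinfOf.

(* A complete Hausdorff pseudometric space is a complete metric space, so X is
   required to be Borel isomorphic to a Polish space. *)
Definition standard_borel (R : realType) (d : measure_display)
    (X : measurableType d) : Prop :=
  exists (P : completePseudoMetricType R) (f : X -> P) (g : P -> X),
    [/\ hausdorff_space P /\ (exists2 S : set P, countable S & dense S),
        cancel f g, cancel g f,
        (forall B : set P, <<s open >> B -> measurable (f @^-1` B)) &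
        (forall B : set X, measurable B -> <<s open >> (g @^-1` B))].

Record standard_action (R : realType) (G : groupType) (d : measure_display)
    (X : measurableType d) (mu : probability X R) := StandardAction {
  sact :> G -> X -> X;
  sact_countable : countable [set: G];
  sact_borel : standard_borel R X;
  sact1 : forall x, sact 1%g x = x;
  sactM : forall g h x, sact (g * h)%g x = sact g (sact h x);
  sact_measurable : forall g, measurable_fun [set: X] (sact g);
  sact_pmp : forall g (B : set X), measurable B -> mu (sact g @^-1` B) = mu B;
  sact_free : {ae mu, forall x, forall g, sact g x = x -> g = 1%g}
}.

Section LinfAction.
Context {R : realType} {G : groupType} {d : measure_display}
  {X : measurableType d} {mu : probability X R}.
Variable alpha : standard_action G mu.

Definition Linf_act (g : G) (a : Linf mu) : Linf mu :=
  Linf_of mu (fun x => Linf_rep a (alpha (g^-1)%g x)).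

Lemma ae_sact g (P : X -> Prop) :
  {ae mu, forall x, P x} -> {ae mu, forall x, P (alpha g x)}.
Proof.
move=> [B [mB B0 PB]]; exists (alpha g @^-1` B); split.
- by rewrite -[_ @^-1` _]setTI; exact: sact_measurable.
- by rewrite sact_pmp.
- by move=> x /= nP; apply: PB.
Qed.

Lemma Lmeas_sact g f :
  f \in Lmeas mu -> (fun x => f (alpha g x)) \in Lmeas mu.
Proof.
move=> /LmeasP[mf [M fM]]; apply/LmeasP; split.
  move=> B; rewrite (_ : _ @^-1` B = alpha g @^-1` (f @^-1` B))//.
  by rewrite -[_ @^-1` (_ @^-1` _)]setTI; exact: sact_measurable.
by exists M; exact: (@ae_sact _ (fun x => `|f x| <= M)).
Qed.

Lemma Linf_act_of g f : f \in Lmeas mu ->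
  Linf_act g (Linf_of mu f) = Linf_of mu (fun x => f (alpha (g^-1)%g x)).
Proof.
move=> Lf; apply: Linf_of_eq; [|exact: Lmeas_sact|].
  exact: (Lmeas_sact _ (Linf_repP _)).
apply: (@ae_sact _ (fun x => Linf_rep (Linf_of mu f) x = f x)).
by apply: Linf_of_ae; rewrite ?Linf_repP ?Linf_repK.
Qed.

Lemma Linf_act1 a : Linf_act 1%g a = a.
Proof.
rewrite -[RHS]Linf_repK; congr (Linf_of mu _).
by apply/funext => x; rewrite invg1 sact1.
Qed.

Lemma Linf_actA g h a : Linf_act (g * h)%g a = Linf_act g (Linf_act h a).
Proof.
rewrite [RHS]Linf_act_of; last exact: (Lmeas_sact _ (Linf_repP _)).
by congr (Linf_of mu _); apply/funext => x; rewrite invgM sactM.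
Qed.

Lemma Linf_actD g a b : Linf_act g (a + b) = Linf_act g a + Linf_act g b.
Proof.
rewrite -[a]Linf_repK -[b]Linf_repK -Linf_ofD ?Linf_repP//.
rewrite !Linf_act_of ?rpredD ?Linf_repP//.
by rewrite -Linf_ofD// Lmeas_sact ?Linf_repP.
Qed.

Lemma Linf_actM g a b : Linf_act g (a * b) = Linf_act g a * Linf_act g b.
Proof.
rewrite -[a]Linf_repK -[b]Linf_repK -Linf_ofM ?Linf_repP//.
rewrite !Linf_act_of ?rpredM ?Linf_repP//.
by rewrite -Linf_ofM// Lmeas_sact ?Linf_repP.
Qed.

Definition Linf_gring : gring G :=
  GRingAct Linf_act1 Linf_actA Linf_actD Linf_actM.

Definition Linf_crossed : nzRingType := crossed Linf_gring.
Definition Linf_mod : lmodType Linf_crossed := base_mod Linf_gring.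

End LinfAction.

Section Modules.
Variable S : nzRingType.

Definition is_basis (M : lmodType S) (I : eqType) (b : I -> M) : Prop :=
  (forall x : M, exists (s : seq I) (c : I -> S),
     x = \sum_(i <- s) c i *: b i) /\
  (forall (s : seq I) (c : I -> S), uniq s ->
     \sum_(i <- s) c i *: b i = 0 -> forall i, i \in s -> c i = 0).

Definition free_module (M : lmodType S) : Prop :=
  exists (I : eqType) (b : I -> M), is_basis b.

Definition projective_module (M : lmodType S) : Prop :=
  forall (A B : lmodType S) (p : {linear A -> B}) (f : {linear M -> B}),
    (forall y, exists x, p x = y) ->
    exists g : {linear M -> A}, forall x, p (g x) = f x.

Definition finitely_generated (M : lmodType S) : Prop :=
  exists (r : nat) (v : 'I_r -> M),
    forall x, exists c : 'I_r -> S, x = \sum_i c i *: v i.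

Record aug_complex (L : lmodType S) := AugComplex {
  cpx :> nat -> lmodType S;
  bd : forall k, {linear cpx k.+1 -> cpx k};
  aug : {linear cpx 0%N -> L};
  bd_bd : forall k x, bd k (bd k.+1 x) = 0;
  aug_bd : forall x, aug (bd 0%N x) = 0
}.

Definition resolution (L : lmodType S) (C : aug_complex L) : Prop :=
  [/\ forall y, exists x, aug C x = y,
      forall x, aug C x = 0 -> exists y, bd C 0%N y = x &
      forall k x, bd C k x = 0 -> exists y, bd C k.+1 y = x].

Definition free_resolution (L : lmodType S) (C : aug_complex L) : Prop :=
  resolution C /\ forall k, free_module (C k).

End Modules.

Definition type_FP (G : groupType) (m : nat) : Prop :=
  exists C : aug_complex (Ztriv G),
    [/\ resolution C, forall k, projective_module (C k) &
        forall k, (k <= m)%N -> finitely_generated (C k)].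

Section Medim.
Context {R : realType} {G : groupType} {d : measure_display}
  {X : measurableType d} {mu : probability X R}.
Variable alpha : standard_action G mu.
Local Notation RR := (Linf_crossed alpha).

Definition cyclic_chi (A : set X) : set RR :=
  [set x | exists r : RR, x = r * mkmalgU 1%g (Linf_chi mu A)].

(* mk_iso is an isomorphism of M onto the submodule
   <A_0> (+) ... (+) <A_(r-1)> of RR^r. *)
Record marking (M : lmodType RR) := Marking {
  mk_rank : nat;
  mk_set : 'I_mk_rank -> set X;
  mk_measurable : forall i, measurable (mk_set i);
  mk_iso : {linear M -> 'rV[RR]_mk_rank};
  mk_inj : injective mk_iso;
  mk_image : range mk_iso = [set v | forall i, cyclic_chi (mk_set i) (v 0 i)]
}.

Definition marked_dim (M : lmodType RR) (m : marking M) : \bar R :=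
  (\sum_(i < mk_rank m) mu (@mk_set _ m i))%E.

Record marked_complex := MarkedComplex {
  mc_cpx :> aug_complex (Linf_mod alpha);
  mc_marking : forall k, marking (mc_cpx k);
  mc_aug_surj : forall y, exists x, aug mc_cpx x = y
}.

Variable C : aug_complex (Ztriv G).

(* There is a Z[G]-chain map C -> D in degrees <= n + 1 extending the inclusion
   of the constants; the components f k with k > n + 1 are unconstrained. *)
Definition embedding (n : nat) (D : marked_complex) : Prop :=
  exists f : forall k, {linear C k -> D k | @ZG_incl G (Linf_gring alpha) \; *:%R},
    (forall x : C 0%N, aug D (f 0%N x) = (aug C x : int)%:~R :> Linf mu) /\
    (forall k, (k <= n)%N -> forall x, bd D k (f k.+1 x) = f k (bd C k x)).

Definition medim (n : nat) : \bar R :=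
  ereal_inf [set v | exists2 D : marked_complex,
                       embedding n D & v = marked_dim (mc_marking D n)].

End Medim.

Section Summation.
Context {R : realType} {T : choiceType}.

(* Meaningful only for absolutely summable families. *)
Definition rsum (f : T -> R) : R :=
  fine (\esum_(t in [set: T]) (Num.max (f t) 0)%:E) -
  fine (\esum_(t in [set: T]) (Num.max (- f t) 0)%:E).

Definition csum (f : T -> R[i]) : R[i] :=
  Complex (rsum (fun t => complex.Re (f t))) (rsum (fun t => complex.Im (f t))).

Definition l2 : set (T -> R[i]) :=
  [set u | (\esum_(t in [set: T])
     (complex.Re (u t) ^+ 2 + complex.Im (u t) ^+ 2)%:E < +oo)%E].

Definition l2_inner (u v : T -> R[i]) : R[i] := csum (fun t => u t * (v t)^*).

(* For a closed subspace V of l2 there is exactly one such p. *)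
Definition l2_proj (V : set (T -> R[i])) (x : T -> R[i]) : T -> R[i] :=
  xget 0 [set p | V p /\ forall w, V w -> l2_inner (x - p) w = 0].

End Summation.

Section L2Betti.
Variables (R : realType) (G : groupType).

(* Vectors of l2(G)^r are functions on 'I_r * G. *)
Definition l2_unit r (i : 'I_r) : 'I_r * G -> R[i] :=
  fun p => (p == (i, 1%g))%:R.

(* The von Neumann dimension tr(P_V) of a closed left G-invariant subspace V of
   l2(G)^r. *)
Definition vN_dim r (V : set ('I_r * G -> R[i])) : R :=
  \sum_i complex.Re (l2_inner (l2_proj V (l2_unit i)) (l2_unit i)).

(* Right multiplication l2(G)^r -> l2(G)^s by a matrix over Z[G]; it is
   id (x) (x |-> x A) on l2(G) (x)_Z[G] Z[G]^r. *)
Definition l2_mulmx r s (A : 'M[ZG G]_(r, s)) (u : 'I_r * G -> R[i]) :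
    'I_s * G -> R[i] :=
  fun p => \sum_i \sum_(h <- msupp (A i p.1))
    (mcoeff h (A i p.1))%:~R * u (i, (p.2 * h^-1)%g).

Section Homology.
Variables (rk : nat -> nat) (A : forall k, 'M[ZG G]_(rk k.+1, rk k)).

Definition l2_cycles n : set ('I_(rk n) * G -> R[i]) :=
  match n with
  | 0 => l2
  | m.+1 => [set u | l2 u /\ l2_mulmx (A m) u = 0]
  end.

(* The reduced l2-homology, i.e. cycles modulo the closure of the boundaries,
   as the orthogonal complement of the boundaries in the cycles. *)
Definition l2_reduced_homology n : set ('I_(rk n) * G -> R[i]) :=
  [set u | l2_cycles u /\
     forall v, l2 v -> l2_inner u (l2_mulmx (A n) v) = 0].

End Homology.

(* b is the dimension of the reduced l2-homology in degree n of some free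
   resolution that is finitely generated in degrees <= n + 1. *)
Definition l2_betti_spec (n : nat) (b : \bar R) : Prop :=
  exists (C : aug_complex (Ztriv G)) (rk : nat -> nat)
         (e : forall k, 'I_(rk k) -> C k)
         (A : forall k, 'M[ZG G]_(rk k.+1, rk k)),
    [/\ free_resolution C,
        forall k, (k <= n.+1)%N -> is_basis (e k),
        forall k, (k <= n)%N -> forall i,
          bd C k (e k.+1 i) = \sum_j A k i j *: e k j &
        b = (vN_dim (@l2_reduced_homology rk A n))%:E].

(* The n-th L2-Betti number, for G of type FP_(n+1) (where l2_betti_spec has a
   unique solution); the value +oo for other groups is a convention. *)
Definition l2_betti (n : nat) : \bar R := xget +oo%E [set b | l2_betti_spec n b].

End L2Betti.

(* Main.v *)
(* Let [R = Linf(alpha, Z) * G] and let [C'] be a free resolution, finitely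
   generated up to degree [n + 1]. An embedding into a marked complex [D]
   gives a chain map [R (x) C' -> D]. Since [Linf] is torsion-free, [R (x)
   C'] is exact, so there is a chain map [D -> R (x) C'] and the composite is
   homotopic to the identity. In degree [n] this is a matrix identity [1 =
   phi psi + L a^* + a Z] over [R], where [a a^*] is the combinatorial
   Laplacian and [phi] factors through the projection [chi] onto [D_n], of
   trace [dim D_n]. Hence [phi] is bounded below on the kernel of the
   Laplacian, and the L2-Betti number, which is the trace of the projection
   onto this kernel, is at most the trace of [chi].

   No completion of [R] is needed: with [N] above the norm of [a a^*], the
   projection onto the kernel is replaced by [Q], the [k]-th power of [1 - a
   a^* / N], which dominates it, and the projection onto the kernel of the
   adjoint of [Q phi] by [E], the analogous power built from [Q phi]. Then [1
   - E] has the same Hilbert-Schmidt norm as its mirror image in the algebra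
   cut down by [chi], and [E Q^2] is small since [Q a] and [E Q phi] are. As
   [R] has integer coefficients, all powers are multiplied by the powers of
   [N] that clear denominators. *)
Require Import Defs.
From HB Require Import structures.
From mathcomp Require Import all_boot all_order all_algebra.
From mathcomp Require Import finmap.
From mathcomp Require Import all_classical all_reals all_analysis.
From mathcomp Require Import measurable_realfun.
From mathcomp Require Import complex.
From mathcomp Require Import -(notations) monalg.
From mathcomp Require Import ring lra.

Set Implicit Arguments.
Unset Strict Implicit.
Unset Printing Implicit Defensive.

Import Order.TTheory GRing.Theory Num.Theory.
Local Open Scope ring_scope.
Local Open Scope classical_set_scope.

(** * Matrices over a ring with involution and trace *)

Lemma mulmxMnr (S : pzSemiRingType) p q r (x : 'M[S]_(p, q))
    (y : 'M[S]_(q, r)) n :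
  x *m (y *+ n) = (x *m y) *+ n.
Proof.
by elim: n => [|n IHn]; rewrite ?mulr0n ?mulmx0// !mulrS mulmxDr IHn.
Qed.

Lemma mulmxMnl (S : pzSemiRingType) p q r (x : 'M[S]_(p, q))
    (y : 'M[S]_(q, r)) n :
  (x *+ n) *m y = (x *m y) *+ n.
Proof.
by elim: n => [|n IHn]; rewrite ?mulr0n ?mul0mx// !mulrS mulmxDl IHn.
Qed.

(** Abstracts a ring of operators with a finite trace: [tau (x * star x)] is the squared 2-norm, and
    [tau_bounded] says that right multiplication by each element is bounded for it. The values lie
    in F, but S need not be an F-algebra. *)
Record tracial (F : realDomainType) (S : nzRingType) := Tracial {
  star : S -> S;
  tau : S -> F;
  star_zmod : zmod_morphism star;
  starM : forall x y, star (x * y) = star y * star x;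
  starK : involutive star;
  tau_zmod : zmod_morphism tau;
  tau_mulC : forall x y, tau (x * y) = tau (y * x);
  tau_star : forall x, tau (star x) = tau x;
  tau_ge0 : forall x, 0 <= tau (x * star x);
  tau_bounded : forall a, exists N : nat,
    forall x, tau (x * a * star (x * a)) <= N%:R * tau (x * star x)
}.

Section TracialMatrix.
Context {F : realDomainType} {S : nzRingType} (t : tracial F S).

HB.instance Definition _ :=
  GRing.isZmodMorphism.Build S S (star t) (star_zmod t).
HB.instance Definition _ :=
  GRing.isZmodMorphism.Build S F (tau t) (tau_zmod t).

Definition adj p q (x : 'M[S]_(p, q)) : 'M[S]_(q, p) :=
  \matrix_(i, j) star t (x j i).

Definition mtr p (x : 'M[S]_p) : F := \sum_i tau t (x i i).

Lemma star1 : star t 1 = 1.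
Proof.
have: star t (1 * star t 1) = 1 by rewrite mul1r starK.
by rewrite starM starK mul1r.
Qed.

Lemma adjK p q : cancel (@adj p q) (@adj q p).
Proof. by move=> x; apply/matrixP => i j; rewrite !mxE starK. Qed.

Lemma adj_zmod p q : zmod_morphism (@adj p q).
Proof. by move=> x y; apply/matrixP => i j; rewrite !mxE raddfB. Qed.
HB.instance Definition _ p q :=
  GRing.isZmodMorphism.Build 'M[S]_(p, q) 'M[S]_(q, p) (@adj p q)
    (@adj_zmod p q).

Lemma adjM p q r (x : 'M[S]_(p, q)) (y : 'M[S]_(q, r)) :
  adj (x *m y) = adj y *m adj x.
Proof.
apply/matrixP => i j; rewrite !mxE raddf_sum; apply: eq_bigr => l _ /=.
by rewrite !mxE starM.
Qed.

Lemma adj1 p : adj 1%:M = 1%:M :> 'M[S]_p.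
Proof.
apply/matrixP => i j; rewrite !mxE raddfMn /= star1.
by rewrite (eq_sym j i).
Qed.

Lemma mtr_zmod p : zmod_morphism (@mtr p).
Proof.
by move=> x y; rewrite /mtr -sumrB; apply: eq_bigr => i _; rewrite !mxE raddfB.
Qed.
HB.instance Definition _ p :=
  GRing.isZmodMorphism.Build 'M[S]_p F (@mtr p) (@mtr_zmod p).

Lemma mtr_mulC p q (x : 'M[S]_(p, q)) (y : 'M[S]_(q, p)) :
  mtr (x *m y) = mtr (y *m x).
Proof.
rewrite /mtr (eq_bigr (fun i => \sum_j tau t (x i j * y j i))) => [|i _].
  rewrite exchange_big; apply: eq_bigr => j _; rewrite mxE raddf_sum /=.
  by apply: eq_bigr => i _; rewrite tau_mulC.
by rewrite mxE raddf_sum /=.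
Qed.

Lemma mtr_adj p (x : 'M[S]_p) : mtr (adj x) = mtr x.
Proof. by apply: eq_bigr => i _; rewrite mxE tau_star. Qed.

Definition ip p q (x y : 'M[S]_(p, q)) : F := mtr (x *m adj y).
Definition sqn p q (x : 'M[S]_(p, q)) : F := ip x x.

Lemma ipC p q (x y : 'M[S]_(p, q)) : ip x y = ip y x.
Proof. by rewrite /ip -mtr_adj adjM adjK. Qed.

Lemma ip_mulr p q r (x : 'M[S]_(p, q)) (a : 'M[S]_(q, r)) y :
  ip (x *m a) y = ip x (y *m adj a).
Proof. by rewrite /ip adjM adjK mulmxA. Qed.

Lemma sqnE p q (x : 'M[S]_(p, q)) :
  sqn x = \sum_i \sum_j tau t (x i j * star t (x i j)).
Proof.
apply: eq_bigr => i _; rewrite mxE raddf_sum /=; apply: eq_bigr => j _.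
by rewrite mxE.
Qed.

Lemma sqn_ge0 p q (x : 'M[S]_(p, q)) : 0 <= sqn x.
Proof.
rewrite sqnE; apply: sumr_ge0 => i _; apply: sumr_ge0 => j _.
exact: tau_ge0.
Qed.

Lemma sqn_adj p q (x : 'M[S]_(p, q)) : sqn (adj x) = sqn x.
Proof. by rewrite /sqn /ip adjK mtr_mulC. Qed.

Lemma sqn_self p (x : 'M[S]_p) : adj x = x -> sqn x = mtr (x *m x).
Proof. by rewrite /sqn /ip => ->. Qed.

Lemma sqnB p q (x y : 'M[S]_(p, q)) :
  sqn (x - y) = sqn x - ip x y *+ 2 + sqn y.
Proof.
rewrite /sqn /ip raddfB /= mulmxBl !mulmxBr !raddfB /= -!/(ip _ _).
by rewrite (ipC y x); ring.
Qed.

Lemma sqnN p q (x : 'M[S]_(p, q)) : sqn (- x) = sqn x.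
Proof. by rewrite /sqn /ip raddfN /= mulmxN mulNmx opprK. Qed.

Lemma sqnD p q (x y : 'M[S]_(p, q)) :
  sqn (x + y) = sqn x + ip x y *+ 2 + sqn y.
Proof.
rewrite -[in LHS](opprK y) sqnB sqnN; congr (_ + _ + _).
by rewrite /ip raddfN /= mulmxN raddfN mulNrn opprK.
Qed.

(** The parallelogram identity with the nonnegative term [sqn (x - y)] dropped. *)
Lemma sqnD_le p q (x y : 'M[S]_(p, q)) : sqn (x + y) <= (sqn x + sqn y) *+ 2.
Proof.
have := sqn_ge0 (x - y); rewrite sqnB sqnD => h.
by rewrite -subr_ge0; move: h; congr (0 <= _); ring.
Qed.

Lemma sqnMn p q (x : 'M[S]_(p, q)) n : sqn (x *+ n) = n%:R ^+ 2 * sqn x.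
Proof.
by rewrite /sqn /ip raddfMn /= mulmxMnr mulmxMnl !raddfMn /=; ring.
Qed.

Lemma ipMnl p q (x y : 'M[S]_(p, q)) n : ip (x *+ n) y = n%:R * ip x y.
Proof. by rewrite /ip mulmxMnl raddfMn /= mulr_natl. Qed.

(** The constant c bounds the square of the norm of right multiplication by a, tested on matrices
    with any number of rows. *)
Definition bounded q r (a : 'M[S]_(q, r)) (c : F) : Prop :=
  forall p (y : 'M[S]_(p, q)), sqn (y *m a) <= c * sqn y.

Lemma bounded_le q r (a : 'M[S]_(q, r)) c c' :
  c <= c' -> bounded a c -> bounded a c'.
Proof.
by move=> cc' ac p y; rewrite (le_trans (ac p y))// ler_wpM2r ?sqn_ge0.
Qed.

Lemma boundedM q r s (a : 'M[S]_(q, r)) (b : 'M[S]_(r, s)) c c' : 0 <= c' ->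
  bounded a c -> bounded b c' -> bounded (a *m b) (c * c').
Proof.
move=> c'0 ac bc' p y; rewrite mulmxA (mulrC c) -mulrA.
by apply: le_trans (bc' _ _) _; rewrite ler_wpM2l.
Qed.

Lemma bounded1 p : bounded 1%:M 1 (q := p).
Proof. by move=> q y; rewrite mulmx1 mul1r. Qed.

Lemma boundedX p (a : 'M[S]_p) c n : 0 <= c ->
  bounded a c -> bounded (a ^+ n) (c ^+ n).
Proof.
move=> c0 ac; elim: n => [|n IHn]; first exact: bounded1.
by rewrite !exprSr; exact: boundedM.
Qed.

(** [adj] preserves [sqn] and turns left multiplication by a into right multiplication by
    [adj a]. *)
Lemma sqn_mull p q r (a : 'M[S]_(p, q)) (y : 'M[S]_(q, r)) c :
  bounded (adj a) c -> sqn (a *m y) <= c * sqn y.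
Proof. by move=> ac; rewrite -sqn_adj adjM -(sqn_adj y). Qed.

(** Iterating the parallelogram bound costs a factor 2 per summand, so C depends on the length of s
    alone and serves all z at once. *)
Lemma tau_sum_le (I : Type) (s : seq I) : exists2 C : nat, (0 < C)%N &
  forall z : I -> S, tau t ((\sum_(l <- s) z l) * star t (\sum_(l <- s) z l))
    <= C%:R * \sum_(l <- s) tau t (z l * star t (z l)).
Proof.
have sqE x : tau t (x * star t x) = sqn (const_mx x : 'M[S]_1).
  by rewrite sqnE !big_ord1 !mxE.
elim: s => [|l s [C C0 IHs]].
  by exists 1%N => // z; rewrite !big_nil mul0r raddf0 mulr0.
exists (2 * C)%N; rewrite ?muln_gt0// => z; rewrite !big_cons.
rewrite [leLHS]sqE raddfD /= (le_trans (sqnD_le _ _))// -!sqE.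
rewrite natrM -mulrA -[leLHS]mulr_natl ler_wpM2l// mulrDr lerD//.
by rewrite ler_peMl ?ler1n// tau_ge0.
Qed.

Lemma boundedP q r (a : 'M[S]_(q, r)) : exists2 N : nat, (0 < N)%N &
  bounded a N%:R.
Proof.
have [N aN] := choice (fun p => tau_bounded t (a p.1 p.2)).
have [C C0 sumC] := tau_sum_le (index_enum 'I_q).
(* [N'] adds the bounds of all entries, so that in each column the sum majorizes the bound of every
   single entry; the successor makes the constant positive. *)
pose N' := (\sum_j \sum_l N (l, j))%N; exists (C * N').+1 => // p y.
apply: le_trans (_ : (C * N')%:R * sqn y <= _); last first.
  by rewrite ler_wpM2r ?sqn_ge0// ler_nat.
rewrite !sqnE mulr_sumr; apply: ler_sum => i _.
under eq_bigr do rewrite !mxE.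
apply: (le_trans (ler_sum _ (fun j _ => sumC (fun l => y i l * a l j)))).
rewrite -mulr_sumr natrM -mulrA ler_wpM2l//.
rewrite natr_sum mulr_suml; apply: ler_sum => j _.
rewrite mulr_sumr; apply: ler_sum => l _.
rewrite (le_trans (aN (l, j) _))// ler_wpM2r ?tau_ge0// ler_nat.
by rewrite (bigD1 l)//= leq_addr.
Qed.

Lemma bounded_pair q r (a : 'M[S]_(q, r)) : exists2 N : nat, (0 < N)%N &
  bounded a N%:R /\ bounded (adj a) N%:R.
Proof.
have [N N0 aN] := boundedP a; have [M M0 aM] := boundedP (adj a).
exists (N + M)%N; first by rewrite addn_gt0 N0.
by split; [apply: bounded_le aN|apply: bounded_le aM];
  rewrite ler_nat ?leq_addr ?leq_addl.
Qed.

(* [N] times the contraction [1 - a a^* / N], whose powers approximate the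
   projection onto the kernel of [a a*]. *)
Definition damp p q (N : nat) (a : 'M[S]_(p, q)) : 'M[S]_p :=
  N%:R - a *m adj a.

Lemma mul_damp p q r N (a : 'M[S]_(p, q)) (y : 'M[S]_(r, p)) :
  y *m damp N a = y *+ N - y *m a *m adj a.
Proof. by rewrite /damp mulmxBr mulmxA mulmxMnr mulmx1. Qed.

Lemma adj_damp p q N (a : 'M[S]_(p, q)) : adj (damp N a) = damp N a.
Proof. by rewrite /damp raddfB /= adjM adjK raddfMn /= adj1. Qed.

Lemma adj_dampX p q N (a : 'M[S]_(p, q)) k :
  adj (damp N a ^+ k) = damp N a ^+ k.
Proof.
elim: k => [|k IHk]; first exact: adj1.
by rewrite exprS -mulmxE adjM adj_damp IHk mulmxE -exprSr exprS.
Qed.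

Section Damp.
Context (p q N : nat) (a : 'M[S]_(p, q)).
Hypothesis aN' : bounded (adj a) N%:R.

(** In the expansion of [y *+ N - y *m a *m adj a] the cross term is -2 N [sqn (y *m a)], and the
    last square is at most N [sqn (y *m a)], as [adj a] is bounded. *)
Lemma sqn_damp r (y : 'M[S]_(r, p)) :
  sqn (y *m damp N a) <= N%:R ^+ 2 * sqn y - N%:R * sqn (y *m a).
Proof.
rewrite mul_damp sqnB sqnMn ipMnl -ip_mulr -/(sqn _).
have := aN' (y *m a); set u := sqn (y *m a); set v := sqn (_ *m adj a).
by rewrite -subr_ge0 -[in X in _ -> X]subr_ge0; congr (0 <= _); ring.
Qed.

Lemma bounded_damp : bounded (damp N a) (N%:R ^+ 2).
Proof.
move=> r y; rewrite (le_trans (sqn_damp y))// gerBl mulr_ge0//.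
exact: sqn_ge0.
Qed.

Lemma bounded_dampX k : bounded (damp N a ^+ k) (N%:R ^+ (2 * k)).
Proof. by rewrite exprM; apply/boundedX/bounded_damp; rewrite exprn_ge0. Qed.

(* Up to normalization, [sqn (damp N a ^+ j *m a)] is nonincreasing in [j] and
   bounded by the decrement of [sqn (damp N a ^+ j)], so [k] times the last
   decrement is at most the initial value. *)
Lemma damp_decay k :
  k%:R * sqn (damp N a ^+ k *m a) <= N%:R ^+ (2 * k).+1 * sqn (1%:M : 'M[S]_p).
Proof.
pose b j := sqn (damp N a ^+ j *m a); pose e j := sqn (damp N a ^+ j).
have bS j : b j.+1 <= N%:R ^+ 2 * b j.
  rewrite /b exprS -mulmxE -mulmxA; apply: sqn_mull.
  by rewrite adj_damp; exact: bounded_damp.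
(* Each step multiplies this potential by at most N^2: the loss in [e] pays exactly for the
   additional copy of [b]. *)
suff: N%:R * e k + k%:R * b k <= N%:R ^+ (2 * k).+1 * e 0.
  by apply: le_trans; rewrite lerDr mulr_ge0// sqn_ge0.
elim: k => [|k IHk]; first by rewrite mul0r addr0 muln0 expr1.
apply: le_trans (_ : N%:R ^+ 2 * (N%:R * e k + k%:R * b k) <= _); last first.
  rewrite (_ : (2 * k.+1).+1 = (2 + (2 * k).+1)%N); last by rewrite mulnS addnS.
  by rewrite exprD -mulrA ler_wpM2l// exprn_ge0.
have eS : e k.+1 <= N%:R ^+ 2 * e k - N%:R * b k.
  by rewrite /e exprSr -mulmxE; exact: sqn_damp.
have N0 : 0 <= N%:R :> F by [].
apply: le_trans (lerD (ler_wpM2l N0 eS) (ler_wpM2l (ler0n F k.+1) (bS k))) _.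
by rewrite -natr1 le_eqVlt; apply/orP; left; apply/eqP; ring.
Qed.

End Damp.

Section Defect.
Context (p m : nat) (e : 'M[S]_p).
Hypothesis e_adj : adj e = e.

Lemma sqn_defect r (y : 'M[S]_(r, p)) :
  sqn (y *m (m%:R - e *m e)) =
  m%:R ^+ 2 * sqn y - m%:R * sqn (y *m e) *+ 2 + sqn (y *m e *m e).
Proof.
rewrite mulmxBr mulmxMnr mulmx1 mulmxA sqnB sqnMn ipMnl.
by rewrite -{2}e_adj -ip_mulr.
Qed.

(** Up to normalization, y is controlled by its images under 1 - e^2 and under e; the term
    [sqn (y *m e *m e)] is dropped. *)
Lemma sqn_defect_ge r (y : 'M[S]_(r, p)) :
  m%:R ^+ 2 * sqn y <= sqn (y *m (m%:R - e *m e)) + m%:R * sqn (y *m e) *+ 2.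
Proof. by rewrite sqn_defect addrAC subrK lerDl sqn_ge0. Qed.

(** Boundedness of the self-adjoint e by m means that [e *m e] has norm at most m, so
    [m%:R - e *m e] lies between 0 and m. *)
Lemma sqn_defect_le r (y : 'M[S]_(r, p)) : bounded e m%:R ->
  sqn (y *m (m%:R - e *m e)) <= m%:R ^+ 2 * sqn y.
Proof.
move=> em; rewrite sqn_defect -addrA gerDl addrC subr_le0.
by apply: le_trans (em _ _) _; rewrite mulr2n lerDl mulr_ge0 ?sqn_ge0.
Qed.

End Defect.

(** With (N - t)^m = N^m - t g(t), the matrix b is g evaluated at [adj a *m a]; in the first
    identity the factor t is spread around b as a and [adj a]. *)
Lemma damp_factor p q N (a : 'M[S]_(p, q)) m : exists b : 'M[S]_q,
  [/\ damp N a ^+ m = (N ^ m)%:R - a *m b *m adj a,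
      damp N (adj a) ^+ m = (N ^ m)%:R - b *m (adj a *m a) &
      GRing.comm (adj a *m a) b].
Proof.
elim: m => [|m [b [IH1 IH2 cb]]].
  exists 0; rewrite !mulmx0 !mul0mx subr0; split; rewrite ?subr0//.
  exact: commr0.
have dE : damp N (adj a) = N%:R - adj a *m a by rewrite /damp adjK.
(* The recursion is g_{m+1}(t) = N^m + g_m(t) (N - t). *)
exists ((N ^ m)%:R + b *m damp N (adj a)); split.
- rewrite exprSr IH1 -mulmxE mul_damp expnSr natrM mulr_natr.
  rewrite mulrnBl mulmxDr dE mulmxBr mulmxMnr mulmx1.
  rewrite !(mulmxDl, mulmxBl, mulmxBr) mulmxMnr mulmx1 !(mulmxMnl, mul1mx).
  rewrite !(mulmxMnr, mulmxMnl, mulmxN, mulNmx) !mulmxA !opprD !opprK !addrA.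
  by congr (_ + _); rewrite addrAC.
- rewrite exprSr IH2 expnSr natrM mulr_natr -mulmxE dE.
  rewrite !(mulmxBl, mulmxBr, mulmxDl) !(mulmxMnr, mulmxMnl) !(mulmx1, mul1mx).
  by rewrite [in RHS]opprD addrA.
- rewrite dE; apply: commrD; first exact: commr_nat.
  by apply: commrM => //; apply: commrB => //; exact: commr_nat.
Qed.

(** The two defects are [a *m b *m adj a] and [b *m (adj a *m a)], both self-adjoint, so their norms
    are traces of squares, which agree by cyclicity. *)
Lemma sqn_damp_swap p q N (a : 'M[S]_(p, q)) m :
  sqn ((N ^ m)%:R - damp N a ^+ m) = sqn ((N ^ m)%:R - damp N (adj a) ^+ m).
Proof.
rewrite !sqn_self; try by rewrite raddfB /= adj_dampX raddfMn /= adj1.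
have [b [-> -> _]] := damp_factor N a m.
by rewrite !subKr -!mulmxA mtr_mulC !mulmxA.
Qed.

(* [chi] is only known to absorb [a] on the right, so it is inserted in front of
   the defect, every term of which ends or starts with [adj a *m a]. *)
Lemma sqn_damp_le p q N (a : 'M[S]_(p, q)) (chi : 'M[S]_q) k :
  bounded a N%:R -> adj chi = chi -> a *m chi = a ->
  sqn ((N ^ (2 * k))%:R - damp N a ^+ (2 * k)) <=
  (N ^ (2 * k))%:R ^+ 2 * sqn chi.
Proof.
move=> aN chi_adj achi; rewrite sqn_damp_swap.
have -> : (N ^ (2 * k))%:R - damp N (adj a) ^+ (2 * k) =
    chi *m ((N ^ (2 * k))%:R - damp N (adj a) ^+ (2 * k)).
  have [b [_ -> cb]] := damp_factor N a (2 * k).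
  rewrite subKr mulmxE -cb -!mulmxE !mulmxA -{1}achi adjM.
  by rewrite chi_adj.
(* The even power is the square of the self-adjoint [damp N (adj a) ^+ k], whose squared norm is at
   most N^(2k). *)
rewrite mul2n -addnn exprD -mulmxE; apply: sqn_defect_le.
  exact: adj_dampX.
by rewrite addnn -mul2n natrX; apply: bounded_dampX; rewrite ?adjK.
Qed.

(** * Dimension estimate from a factorization of the identity *)

Section Estimate.
Context (p l q N : nat) (a : 'M[S]_(p, l)) (phi : 'M[S]_(p, q)).
Context (psi : 'M[S]_(q, p)) (chi : 'M[S]_q).
Context (L : 'M[S]_(p, l)) (Z : 'M[S]_(l, p)).
Hypothesis N_gt0 : (0 < N)%N.
Hypothesis aN' : bounded (adj a) N%:R.
Hypothesis chi_adj : adj chi = chi.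
Hypothesis phi_chi : phi *m chi = phi.
Hypothesis split1 : 1%:M = phi *m psi + L *m adj a + a *m Z.

(** After division by k (N^(2k))^2 the right side is [sqn chi] plus K/k with K independent of k, so
    the error vanishes as k grows. *)
Lemma sqn_damp_estimate : exists K : F, forall k,
  k%:R * sqn (damp N a ^+ (2 * k)) <=
  (N%:R ^+ (2 * k)) ^+ 2 * (k%:R * sqn chi + K).
Proof.
have [C C0 [phiC phiC']] := bounded_pair phi.
have [Cpsi _ [psiC _]] := bounded_pair psi.
have [CL _ [_ LC]] := bounded_pair L.
have [CZ _ [ZC _]] := bounded_pair Z.
pose r := sqn (1%:M : 'M[S]_p).
(* One summand for each of the three terms of [split1]; the factor 8 below is the 4 of [step] times
   the 2 of [main]. *)
pose K0 := r * (Cpsi%:R * C%:R + CL%:R * N%:R + CZ%:R * N%:R).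
exists (K0 *+ 8) => k.
(* u, M and m bound the squared norms of Q, of [T = Q *m phi] and of E: they are N^(2k), C u and
   M^(2k). *)
pose u : nat := (N ^ (2 * k))%N.
pose M := (C * u)%N; pose m := (M ^ (2 * k))%N.
have uE : u%:R = N%:R ^+ (2 * k) :> F by rewrite natrX.
have mE : m%:R = M%:R ^+ (2 * k) :> F by rewrite natrX.
set Q := damp N a ^+ k.
have Qadj : adj Q = Q by exact: adj_dampX.
have Qu : bounded Q u%:R by rewrite uE; exact: bounded_dampX.
pose T := Q *m phi.
have TM : bounded T M%:R.
  by rewrite /M mulnC natrM; apply: boundedM.
have TM' : bounded (adj T) M%:R.
  by rewrite /T adjM Qadj /M natrM; apply: boundedM.
pose E := damp M T ^+ k.
have Eadj : adj E = E by exact: adj_dampX.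
have Em : bounded E m%:R by rewrite mE; apply: bounded_dampX.
pose Q2 := damp N a ^+ (2 * k).
have Q2E : Q2 = Q *m Q by rewrite /Q2 mul2n -addnn exprD.
have Q2adj : adj Q2 = Q2 by exact: adj_dampX.
have Q2u : bounded Q2 (u%:R ^+ 2) by rewrite Q2E expr2; exact: boundedM.
have EE : damp M T ^+ (2 * k) = E *m E by rewrite mul2n -addnn exprD.
(* Split Q^2 along E. Up to the normalizing factors, the part seen by 1 - E^2 is at most [sqn chi]
   because [T *m chi = T]; the part seen by E is estimated in [step]. *)
have main : m%:R ^+ 2 * sqn Q2 <=
    u%:R ^+ 2 * (m%:R ^+ 2 * sqn chi) + m%:R * sqn (E *m Q2) *+ 2.
  apply: (le_trans (sqn_defect_ge m Eadj Q2)); apply: lerD; last first.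
    by rewrite -[sqn (E *m Q2)]sqn_adj adjM Q2adj Eadj.
  rewrite -EE -sqn_adj adjM Q2adj raddfB /= adj_dampX raddfMn /= adj1.
  apply: le_trans (Q2u _ _) _; rewrite ler_wpM2l ?exprn_ge0//.
  by apply: sqn_damp_le => //; rewrite /T -mulmxA phi_chi.
have Tdec := damp_decay TM' k.
have adec := damp_decay aN' k.
rewrite -/Q -/E -/r !exprS -mE -uE in Tdec adec.
(* [E Q^2 = E Q 1 Q] is expanded with [split1]; each term contains one of the
   small factors [E T], [adj a Q], [Q a]. *)
have step : k%:R * sqn (E *m Q2) <= K0 *+ 4 * (m%:R * u%:R ^+ 2).
  have -> : E *m Q2 = (E *m T) *m (psi *m Q) +
      (E *m Q *m L *m (adj a *m Q) + E *m (Q *m a) *m (Z *m Q)).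
    rewrite Q2E -[X in X *m Q]mulmx1 split1.
    by rewrite !(mulmxDl, mulmxDr) !mulmxA -addrA.
  have E_left r' (x : 'M[S]_(p, r')) : sqn (E *m x) <= m%:R * sqn x.
    by apply: sqn_mull; rewrite Eadj.
  have Q_left r' (x : 'M[S]_(p, r')) : sqn (Q *m x) <= u%:R * sqn x.
    by apply: sqn_mull; rewrite Qadj.
  have s1 : sqn (E *m T *m (psi *m Q)) <= sqn (E *m T) * Cpsi%:R * u%:R.
    rewrite mulmxA (le_trans (Qu _ _))// mulrC ler_wpM2r//.
    by rewrite (le_trans (psiC _ _))// mulrC.
  have s2 : sqn (E *m Q *m L *m (adj a *m Q)) <=
      m%:R * u%:R * CL%:R * sqn (Q *m a).
    rewrite -!mulmxA (le_trans (E_left _ _))// -!mulrA ler_wpM2l//.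
    rewrite (le_trans (Q_left _ _))// ler_wpM2l//.
    by rewrite (le_trans (sqn_mull _ LC))// -sqn_adj adjM Qadj adjK.
  have s3 : sqn (E *m (Q *m a) *m (Z *m Q)) <=
      m%:R * u%:R * CZ%:R * sqn (Q *m a).
    rewrite mulmxA (le_trans (Qu _ _))// [m%:R * _]mulrC -!mulrA ler_wpM2l//.
    rewrite (le_trans (ZC _ _))// mulrCA ler_wpM2l//.
  (* Two uses of [sqnD_le] give weight 2 to the first term and weight 4 to the other two. *)
  apply: le_trans (_ : k%:R * ((sqn (E *m T) * Cpsi%:R * u%:R) *+ 2 +
      (m%:R * u%:R * CL%:R * sqn (Q *m a)) *+ 4 +
      (m%:R * u%:R * CZ%:R * sqn (Q *m a)) *+ 4) <= _).
    rewrite ler_wpM2l//; apply: le_trans (sqnD_le _ _) _.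
    rewrite mulrnDl -[leRHS]addrA lerD ?lerMn2r//.
    rewrite -mulrnDl -[4%N]/(2 * 2)%N mulrnA lerMn2r /=.
    by apply: le_trans (sqnD_le _ _) _; rewrite lerMn2r /= lerD.
  have h1 : 0 <= (Cpsi%:R * u%:R) * (M%:R * (m%:R * r) - k%:R * sqn (E *m T)).
    by apply: mulr_ge0; rewrite ?mulr_ge0// subr_ge0 mulrA.
  have h2 : 0 <= (m%:R * u%:R * (CL%:R + CZ%:R)) *
      (N%:R * (u%:R * r) - k%:R * sqn (Q *m a)).
    apply: mulr_ge0; first by rewrite !(mulr_ge0, addr_ge0).
    by rewrite subr_ge0 mulrA.
  (* Slack: the first term has weight 2, while all of K0 is taken 4 times. *)
  have h3 : 0 <= Cpsi%:R * u%:R * (C%:R * u%:R) * (m%:R * r).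
    by rewrite !mulr_ge0// sqn_ge0.
  move: h1 h2 h3; rewrite /K0 /M natrM.
  by set x := sqn _; set y := sqn _ => h1 h2 h3; nra.
have m_gt0 : 0 < m%:R :> F.
  by rewrite ltr0n !expn_gt0 muln_gt0 C0 expn_gt0 N_gt0.
rewrite -uE -(ler_pM2l (exprn_gt0 2 m_gt0)).
have := ler_wpM2l (ler0n F k) main.
have := ler_wpM2l (ltW m_gt0) step.
by set x := sqn _; set y := sqn _; set z := sqn _ => h1 h2; nra.
Qed.

End Estimate.

End TracialMatrix.

(** Here c stands for the trace of the projection onto the kernel of [a *m adj a]: the last
    hypothesis says that every normalized power dominates it, and letting k grow in
    [sqn_damp_estimate] compares it with chi. *)
Lemma spectral_bound (F : archiRealFieldType) (S : nzRingType)
    (t : tracial F S) (p l q N : nat) (a : 'M[S]_(p, l)) (phi : 'M[S]_(p, q))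
    (psi : 'M[S]_(q, p)) (chi : 'M[S]_q) (L : 'M[S]_(p, l)) (Z : 'M[S]_(l, p))
    (c : F) :
  (0 < N)%N -> bounded t (adj t a) N%:R -> adj t chi = chi ->
  phi *m chi = phi ->
  1%:M = phi *m psi + L *m adj t a + a *m Z ->
  (forall k, (N%:R ^+ k) ^+ 2 * c <= sqn t (damp t N a ^+ k)) ->
  c <= sqn t chi.
Proof.
move=> N0 aN chi_adj phi_chi split1 hc.
have [K hK] := sqn_damp_estimate N0 aN chi_adj phi_chi split1.
rewrite leNgt; apply/negP; rewrite -subr_gt0 => d0.
(* If c exceeded [sqn chi], a k with k (c - [sqn chi]) > |K| + 1 would contradict the estimate. *)
have := archi_boundP (ltW (divr_gt0 (ltr_wpDl (normr_ge0 K) ltr01) d0)).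
set k := Num.bound _; rewrite ltr_pdivrMr// => kK.
have Nk : 0 < (N%:R ^+ (2 * k)) ^+ 2 :> F by rewrite !exprn_gt0// ltr0n.
have := le_trans (ler_wpM2l (ler0n F k) (hc (2 * k)%N)) (hK k).
rewrite mulrCA ler_pM2l// -lerBlDl -mulrBr leNgt.
rewrite (le_lt_trans (ler_norm K))// (le_lt_trans _ kK)//.
by rewrite lerDl.
Qed.

(** * Traces on crossed products *)

(** Elements of A stand for real-valued functions, so A carries the trivial involution and [a * a]
    plays the part of |a|^2. *)
Record invariant_trace (F : realDomainType) (G : groupType) (A : gring G) :=
  InvariantTrace {
    itr : A -> F;
    itr_zmod : zmod_morphism itr;
    itr_gact : forall g a, itr (gact g a) = itr a;
    itr_ge0 : forall a, 0 <= itr (a * a);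
    itr_bounded : forall a, exists N : nat,
      forall b, itr (b * b * (a * a)) <= N%:R * itr (b * b)
  }.

Section CrossedTrace.
Context {F : realDomainType} {G : groupType} {A : gring G}.
Variable t : invariant_trace F A.
Local Notation R := (crossed A).
Implicit Types (x y z : R) (g h : G) (a b : A).

HB.instance Definition _ :=
  GRing.isZmodMorphism.Build A F (itr t) (itr_zmod t).

Lemma crossed_mulUE g h a b :
  (mkmalgU g a : R) * mkmalgU h b = mkmalgU (g * h)%g (a * gact g b).
Proof. exact: crossed_mulU. Qed.

(** The adjoint of a g is g^{-1} a, that is (g^{-1} . a) g^{-1}. *)
Definition cstarF g a : R := mkmalgU (g^-1)%g (gact (g^-1)%g a).
Lemma cstarF_zmod g : zmod_morphism (cstarF g).
Proof. by move=> a b; rewrite /cstarF raddfB monalgUB. Qed.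
HB.instance Definition _ g :=
  GRing.isZmodMorphism.Build A R (cstarF g) (cstarF_zmod g).

Definition cstar x : R := malg_ext cstarF x.
Lemma cstar_zmod : zmod_morphism cstar.
Proof. by move=> x y; rewrite /cstar raddfB. Qed.
HB.instance Definition _ := GRing.isZmodMorphism.Build R R cstar cstar_zmod.

Lemma cstarU g a : cstar (mkmalgU g a) = mkmalgU (g^-1)%g (gact (g^-1)%g a).
Proof. exact: malg_extU. Qed.

Lemma cstarM x y : cstar (x * y) = cstar y * cstar x.
Proof.
elim/(@crossed_ind G A): x => [g a|x x' IHx IHx']; last first.
  by rewrite mulrDl !raddfD /= IHx IHx' mulrDr.
elim/(@crossed_ind G A): y => [h b|y y' IHy IHy']; last first.
  by rewrite mulrDr !raddfD /= IHy IHy' mulrDl.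
rewrite crossed_mulUE !cstarU crossed_mulUE invgM gact_mul gactM; congr mkmalgU.
by rewrite -[gact g^-1 (gact g b)]gact_mul mulVg gact_one mulrC gactM.
Qed.

Lemma cstarK : involutive cstar.
Proof.
elim/(@crossed_ind G A) => [g a|x y IHx IHy]; last first.
  by rewrite !raddfD /= IHx IHy.
by rewrite !cstarU invgK -gact_mul mulgV gact_one.
Qed.

Definition ctau x : F := itr t (mcoeff 1%g x).
Lemma ctau_zmod : zmod_morphism ctau.
Proof. by move=> x y; rewrite /ctau mcoeffB raddfB. Qed.
HB.instance Definition _ := GRing.isZmodMorphism.Build R F ctau ctau_zmod.

Lemma ctauU g a : ctau (mkmalgU g a) = itr t a *+ (g == 1%g).
Proof. by rewrite /ctau mcoeffU raddfMn eq_sym. Qed.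

Lemma ctau_mulC x y : ctau (x * y) = ctau (y * x).
Proof.
elim/(@crossed_ind G A): x => [g a|x x' IHx IHx']; last first.
  by rewrite mulrDl mulrDr !raddfD /= IHx IHx'.
elim/(@crossed_ind G A): y => [h b|y y' IHy IHy']; last first.
  by rewrite mulrDl mulrDr !raddfD /= IHy IHy'.
rewrite !crossed_mulUE !ctauU.
have -> : (g * h == 1)%g = (h * g == 1)%g.
  by rewrite !mulg_eq1 -[in RHS](inj_eq invg_inj) invgK eq_sym.
case: eqP => [hg1|]//; rewrite !mulr1n -(itr_gact t h (_ * _)).
by rewrite gactM -gact_mul hg1 gact_one mulrC.
Qed.

Lemma ctau_star x : ctau (cstar x) = ctau x.
Proof.
elim/(@crossed_ind G A): x => [g a|x x' IHx IHx']; last first.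
  by rewrite !raddfD /= IHx IHx'.
by rewrite cstarU !ctauU itr_gact invg_eq1.
Qed.

Definition cpairF y g a : F := itr t (a * mcoeff g y).
Lemma cpairF_zmod y g : zmod_morphism (cpairF y g).
Proof. by move=> a b; rewrite /cpairF mulrBl raddfB. Qed.
HB.instance Definition _ y g :=
  GRing.isZmodMorphism.Build A F (cpairF y g) (cpairF_zmod y g).

(** Terms over distinct group elements are orthogonal, so positivity and boundedness reduce to the
    coefficients. *)
Lemma ctau_mul_star x y :
  ctau (x * cstar y) = \sum_(g <- msupp x) itr t (mcoeff g x * mcoeff g y).
Proof.
rewrite -[RHS]/(malg_ext (cpairF y) x).
elim/(@crossed_ind G A): x => [g a|x x' IHx IHx']; last first.
  by rewrite mulrDl !raddfD /= IHx IHx'.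
rewrite malg_extU /= /cpairF.
elim/(@crossed_ind G A): y => [h b|y y' IHy IHy']; last first.
  by rewrite raddfD mulrDr mcoeffD mulrDr !raddfD /= IHy IHy'.
rewrite cstarU crossed_mulUE ctauU mcoeffU -gact_mul.
case: (eqVneq g h) => [->|gh].
  by rewrite mulgV eqxx gact_one.
by rewrite divg_eq1 (negPf gh) !mulr0n mulr0 raddf0.
Qed.

Lemma mcoeff_mulU1 x b g :
  mcoeff g (x * (mkmalgU 1%g b : R)) = mcoeff g x * gact g b.
Proof.
elim/(@crossed_ind G A): x => [h a|x x' IHx IHx']; last first.
  by rewrite mulrDl !mcoeffD IHx IHx' mulrDl.
rewrite crossed_mulUE mulg1 !mcoeffU.
by case: eqP => [->|]; rewrite ?mulr0n ?mul0r.
Qed.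

Lemma ctau_ge0 x : 0 <= ctau (x * cstar x).
Proof. by rewrite ctau_mul_star sumr_ge0// => g _; exact: itr_ge0. Qed.

(** The bound of [sqnD_le], proved here on the way to the [tracial] structure which that lemma
    presupposes. *)
Lemma ctauD_le x y : ctau ((x + y) * cstar (x + y)) <=
  (ctau (x * cstar x) + ctau (y * cstar y)) *+ 2.
Proof.
have aux (a b c d : F) :
    0 <= a - b - (c - d) -> a + b + (c + d) <= (a + d) *+ 2.
  by lra.
have tD (u v : R) : ctau (u + v) = ctau u + ctau v by exact: raddfD.
have sB (u v : R) : cstar (u - v) = cstar u - cstar v by exact: raddfB.
have sD (u v : R) : cstar (u + v) = cstar u + cstar v by exact: raddfD.
have h : 0 <= ctau (x * cstar x) - ctau (x * cstar y) -
    (ctau (y * cstar x) - ctau (y * cstar y)).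
  by rewrite -!ctau_zmod -!mulrBr -mulrBl -sB ctau_ge0.
rewrite sD mulrDl !mulrDr !tD.
exact: aux h.
Qed.

(** For a single term x = (b, h), [x * cstar x] is (b b, 1): the coefficient of y at g is multiplied
    by g . (b b), and invariance of the trace under g^{-1} reduces this to [itr_bounded]. Sums are
    handled by [ctauD_le]. *)
Lemma ctau_bounded x : exists N : nat, forall y,
  ctau (y * x * cstar (y * x)) <= N%:R * ctau (y * cstar y).
Proof.
elim/(@crossed_ind G A): x => [h b|x x' [N xN] [N' xN']]; last first.
  exists ((N + N') * 2)%N => y; rewrite mulrDr (le_trans (ctauD_le _ _))//.
  by rewrite natrM mulrAC mulr_natr lerMn2r /= natrD mulrDl lerD.
have [N bN] := itr_bounded t b; exists N => y.
have -> : ctau (y * mkmalgU h b * cstar (y * mkmalgU h b)) =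
    ctau (y * cstar (y * (mkmalgU 1%g (b * b) : R))).
  rewrite !cstarM !cstarU -mulrA; congr (ctau (_ * _)).
  rewrite mulrA crossed_mulUE mulgV -gact_mul mulgV invg1 !gact_one.
  by [].
rewrite !ctau_mul_star mulr_sumr; apply: ler_sum => g _.
rewrite mcoeff_mulU1; set c := mcoeff g y.
rewrite -(itr_gact t (g^-1)%g (c * (c * _))) -(itr_gact t (g^-1)%g (c * c)).
by rewrite !gactM -!gact_mul mulVg gact_one mulrA bN.
Qed.

Definition crossed_tracial : tracial F (crossed A) :=
  Tracial cstar_zmod cstarM cstarK ctau_zmod ctau_mulC ctau_star ctau_ge0
    ctau_bounded.

End CrossedTrace.

(** * The group ring inside the crossed product *)

Section GroupRing.
Variables (F : realDomainType) (G : groupType).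

Lemma intr_bounded (a : int) : exists N : nat,
  forall b : int, (b * b * (a * a))%:~R <= N%:R * (b * b)%:~R :> F.
Proof.
exists (absz (a * a)) => b; rewrite intrM mulrC ler_wpM2r//.
  by rewrite ler0z -expr2 sqr_ge0.
by rewrite natr_absz ler_int ler_norm.
Qed.

Lemma intr_sqr_ge0 (a : int) : 0 <= (a * a)%:~R :> F.
Proof. by rewrite ler0z -expr2 sqr_ge0. Qed.

Definition int_trace : invariant_trace F (int_gring G) :=
  @InvariantTrace F G (int_gring G) (intr : int -> F) (@intrB F)
    (fun _ _ => erefl) intr_sqr_ge0 intr_bounded.

Definition ZG_tracial : tracial F (ZG G) := crossed_tracial int_trace.

Context {A : gring G} (t : invariant_trace F A).
Hypothesis itr1 : itr t 1 = 1.
Local Notation incl := (@ZG_incl G A).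

Lemma itr_int (n : int) : itr t n%:~R = n%:~R.
Proof. by rewrite raddfMz /= itr1. Qed.

Lemma ZG_incl_star (x : ZG G) :
  cstar (incl x) = incl (cstar x).
Proof.
elim/(@crossed_ind G (int_gring G)): x => [g n|x y IHx IHy]; last first.
  by rewrite !raddfD /= IHx IHy.
rewrite ZG_inclU (cstarU _ (n%:~R : A)) (@cstarU G (int_gring G)).
by rewrite ZG_inclU gact_int.
Qed.

Lemma tau_ZG_incl (x : ZG G) :
  ctau t (incl x) = ctau int_trace x.
Proof.
elim/(@crossed_ind G (int_gring G)): x => [g n|x y IHx IHy]; last first.
  by rewrite !raddfD /= IHx IHy.
by rewrite ZG_inclU (ctauU _ _ (n%:~R : A)) (@ctauU F G (int_gring G)) itr_int.
Qed.

Lemma map_incl_adj p q (x : 'M[ZG G]_(p, q)) :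
  adj (crossed_tracial t) (map_mx incl x) = map_mx incl (adj ZG_tracial x).
Proof. by apply/matrixP => i j; rewrite !mxE; exact: ZG_incl_star. Qed.

(** The inclusion commutes with the involution and preserves the trace, hence is isometric: lower
    bounds found over the group ring hold over the crossed product. *)
Lemma sqn_map_incl p q (x : 'M[ZG G]_(p, q)) :
  sqn (crossed_tracial t) (map_mx incl x) = sqn ZG_tracial x.
Proof.
rewrite !sqnE; apply: eq_bigr => i _; apply: eq_bigr => j _.
by rewrite mxE /= ZG_incl_star -rmorphM tau_ZG_incl.
Qed.

Lemma map_incl_damp p q N (a : 'M[ZG G]_(p, q)) k :
  map_mx incl (damp ZG_tracial N a ^+ k) =
  damp (crossed_tracial t) N (map_mx incl a) ^+ k.
Proof.
elim: k => [|k IHk]; first by rewrite !expr0 map_mx1.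
rewrite !exprS -!mulmxE map_mxM IHk; congr (_ *m _).
by rewrite /damp map_mxB map_mxM map_incl_adj raddfMn /= map_mx1.
Qed.

End GroupRing.

(** * The l2-homology side *)

Lemma max0_sub (R : realDomainType) (x : R) :
  Num.max x 0 - Num.max (- x) 0 = x.
Proof.
by case: (lerP x 0) => hx; case: (lerP (- x) 0) => hNx; lra.
Qed.

Section RealSums.
Context {R : realType} {T : choiceType}.
Implicit Types (f g : T -> R) (s : seq T).

Lemma esum_finite_support f s : uniq s -> (forall t, 0 <= f t) ->
  (forall t, t \notin s -> f t = 0) ->
  \esum_(t in [set: T]) (f t)%:E = (\sum_(t <- s) f t)%:E.
Proof.
move=> us f0 fs.
transitivity (\esum_(t in [set: T])
    \sum_(j <- s) (if t \in [set j] then (f t)%:E else 0))%E.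
  apply: eq_esum => t _; have [ts|ts] := boolP (t \in s).
    rewrite (bigD1_seq t)//= big1 ?adde0 => [|j jt]; first by rewrite mem_set.
    by rewrite memNset// => tj; rewrite -tj eqxx in jt.
  by rewrite fs// big1_seq// => j /= js; case: ifP.
rewrite esum_sum => [|t j _ _]; last by case: ifP; rewrite ?lee_fin.
rewrite -sumEFin; apply: eq_bigr => j _.
by rewrite -esum_mkcond esum_set1// lee_fin.
Qed.

Lemma rsum_finite_support f s : uniq s -> (forall t, t \notin s -> f t = 0) ->
  rsum f = \sum_(t <- s) f t.
Proof.
move=> us fs; rewrite /rsum.
rewrite (@esum_finite_support (fun t => Num.max (f t) 0) s)//; first last.
- by move=> t /fs ->; rewrite maxxx.
- by move=> t; rewrite le_max lexx orbT.
rewrite (@esum_finite_support (fun t => Num.max (- f t) 0) s)//; first last.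
- by move=> t /fs ->; rewrite oppr0 maxxx.
- by move=> t; rewrite le_max lexx orbT.
by rewrite /= -sumrB; apply: eq_bigr => t _; rewrite max0_sub.
Qed.

(** f and g need not be the positive and negative parts of f - g, which enter [rsum]; by summability
    both decompositions give the same difference. *)
Lemma rsumB f g : (forall t, 0 <= f t) -> (forall t, 0 <= g t) ->
  (\esum_(t in [set: T]) (f t)%:E < +oo)%E ->
  (\esum_(t in [set: T]) (g t)%:E < +oo)%E ->
  rsum (fun t => f t - g t) = fine (\esum_(t in [set: T]) (f t)%:E) -
    fine (\esum_(t in [set: T]) (g t)%:E).
Proof.
move=> f0 g0 sf sg.
have summ (h : T -> R) : (forall t, 0 <= h t) ->
    (\esum_(t in [set: T]) (h t)%:E < +oo)%E ->
    summable [set: T] (EFin \o h).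
  move=> h0; apply: le_lt_trans; apply: le_esum => t _ /=.
  by rewrite lee_fin ger0_norm.
have fsum := summ _ f0 sf; have gsum := summ _ g0 sg.
have finB : (\esum_(t in [set: T]) ((EFin \o f) \- (EFin \o g))^\+ t
    \is a fin_num)%E.
  have := summable_funepos (summableB fsum gsum).
  rewrite summableE; congr (_ \is a fin_num); apply: eq_esum => t _.
  by rewrite gee0_abs.
have finC : (\esum_(t in [set: T]) ((EFin \o f) \- (EFin \o g))^\- t
    \is a fin_num)%E.
  have := summable_funeneg (summableB fsum gsum).
  rewrite summableE; congr (_ \is a fin_num); apply: eq_esum => t _.
  by rewrite gee0_abs.
have fin (h : T -> R) : (forall t, 0 <= h t) ->
    (\esum_(t in [set: T]) (h t)%:E < +oo)%E ->
    (\esum_(t in [set: T]) (h t)%:E)%E \is a fin_num.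
  by move=> h0 hs; rewrite ge0_fin_numE// esum_ge0// => t _; rewrite lee_fin.
rewrite -fineB ?fin//.
have := esumB fsum gsum; rewrite /= => <- => [|t _|t _]; rewrite ?lee_fin//.
rewrite fineB// /rsum; congr (fine _ - fine _); apply: eq_esum => t _.
  by rewrite funeposE EFin_max.
by rewrite funenegE EFin_max EFinN.
Qed.

End RealSums.

Section Pairing.
Context {R : realType} {G : groupType}.
Local Notation tZ := (ZG_tracial R G).

Definition row_fun r (w : 'rV[ZG G]_r) (p : 'I_r * G) : R :=
  (mcoeff p.2 (w 0 p.1))%:~R.

Definition row_supp r (w : 'rV[ZG G]_r) : seq ('I_r * G) :=
  [seq (i, g) | i <- enum 'I_r, g <- (msupp (w 0 i) : seq G)].

Lemma row_supp_uniq r (w : 'rV[ZG G]_r) : uniq (row_supp w).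
Proof.
apply: allpairs_uniq_dep; first exact: enum_uniq.
- by move=> i _; exact: fset_uniq.
- by move=> [i g] [j h] _ _ /= [-> ->].
Qed.

Lemma row_fun_out r (w : 'rV[ZG G]_r) p :
  p \notin row_supp w -> row_fun w p = 0.
Proof.
move=> pw; rewrite /row_fun mcoeff_outdom//; apply: contra pw => pw.
apply/allpairsPdep; exists p.1, p.2; split=> //; first by rewrite mem_enum.
by case: (p).
Qed.

Definition pairF r (a : 'I_r * G -> R) (i : 'I_r) (g : G) (n : int) : R :=
  n%:~R * a (i, g).
Lemma pairF_zmod r (a : 'I_r * G -> R) i g : zmod_morphism (pairF a i g).
Proof. by move=> m n; rewrite /pairF intrB mulrBl. Qed.
HB.instance Definition _ r (a : 'I_r * G -> R) i g :=
  GRing.isZmodMorphism.Build int R (pairF a i g) (pairF_zmod a i g).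

(** The real inner product with a finitely supported integral vector: a finite sum, hence defined
    for every function a. Writing it with [malg_ext] gives additivity in w. *)
Definition pairing r (a : 'I_r * G -> R) (w : 'rV[ZG G]_r) : R :=
  \sum_i malg_ext (pairF a i) (w 0 i).
Lemma pairing_zmod r (a : 'I_r * G -> R) : zmod_morphism (pairing a).
Proof.
move=> v w; rewrite /pairing -sumrB; apply: eq_bigr => i _.
by rewrite !mxE raddfB.
Qed.
HB.instance Definition _ r (a : 'I_r * G -> R) :=
  GRing.isZmodMorphism.Build 'rV[ZG G]_r R (pairing a) (pairing_zmod a).

Lemma sum_row_supp r (w : 'rV[ZG G]_r) (F : 'I_r * G -> R) :
  \sum_(p <- row_supp w) F p = \sum_i \sum_(g <- msupp (w 0 i)) F (i, g).
Proof. by rewrite big_allpairs_dep big_enum. Qed.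

Lemma pairingE r a (w : 'rV[ZG G]_r) :
  pairing a w = \sum_(p <- row_supp w) row_fun w p * a p.
Proof. by rewrite sum_row_supp. Qed.

Lemma sqn_row_supp r (w : 'rV[ZG G]_r) :
  sqn tZ w = \sum_(p <- row_supp w) row_fun w p ^+ 2.
Proof.
rewrite sum_row_supp sqnE big_ord1; apply: eq_bigr => i _.
rewrite [LHS]ctau_mul_star; apply: eq_bigr => g _.
by rewrite /row_fun /= expr2 intrM.
Qed.

Lemma pairing_single r a (i : 'I_r) g n :
  pairing a ((mkmalgU g n : ZG G) *: delta_mx 0 i) = n%:~R * a (i, g).
Proof.
rewrite /pairing (bigD1 i)//= big1 ?addr0 => [|j ji]; rewrite !mxE.
  by rewrite !eqxx mulr1 malg_extU.
by rewrite (negPf ji) mulr0 raddf0.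
Qed.

Lemma row_ind r (P : 'rV[ZG G]_r -> Prop) : P 0 ->
  (forall v w, P v -> P w -> P (v + w)) ->
  (forall i g n, P ((mkmalgU g n : ZG G) *: delta_mx 0 i)) -> forall w, P w.
Proof.
move=> P0 PD PU w; rewrite (row_sum_delta w); elim/big_ind: _ => // i _.
elim/(@crossed_ind G (int_gring G)): (w 0 i) => [g n|x y Px Py].
  exact: PU.
by rewrite scalerDl; exact: PD.
Qed.

Lemma malg_ext_mul_star r (a : 'I_r * G -> R) i g (n : int) (y : ZG G) :
  malg_ext (pairF a i) ((mkmalgU g n : ZG G) * cstar y) =
  n%:~R * \sum_(h <- msupp y) (mcoeff h y)%:~R * a (i, (g * h^-1)%g).
Proof.
(* The sum over the support of y is [malg_ext] for a translate of a, hence additive in y. *)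
pose a' (p : 'I_1 * G) := a (i, (g * p.2^-1)%g).
rewrite -[X in _ = _ * X]/(malg_ext (pairF a' 0) y).
elim/(@crossed_ind G (int_gring G)): y => [h m|x y IHx IHy]; last first.
  by rewrite [cstar _]raddfD mulrDr !raddfD /= IHx IHy mulrDr.
by rewrite cstarU crossed_mulUE !malg_extU /= /pairF intrM mulrA.
Qed.

Local Notation Re := (@complex.Re R).

Lemma ReM_int (n : int) (z : R[i]) : Re (n%:~R * z) = n%:~R * Re z.
Proof.
rewrite -[n%:~R](rmorph_int (real_complex R)).
by case: z => x y /=; rewrite mul0r subr0.
Qed.

(** Right multiplication by [adj tZ B] is adjoint to [l2_mulmx B]; by additivity it is enough to
    check rows with a single monomial. *)
Lemma pairing_mul_adj r s (B : 'M[ZG G]_(r, s)) (u : 'I_r * G -> R[i])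
    (w : 'rV[ZG G]_s) :
  pairing (Re \o u) (w *m adj tZ B) = pairing (Re \o l2_mulmx B u) w.
Proof.
elim/row_ind: w => [|v w IHv IHw|j g n].
- by rewrite mul0mx !raddf0.
- by rewrite mulmxDl !raddfD /= IHv IHw.
- rewrite pairing_single /= /l2_mulmx raddf_sum mulr_sumr.
  apply: eq_bigr => i _ /=.
  rewrite -scalemxAl -rowE !mxE malg_ext_mul_star raddf_sum; congr (_ * _).
  by apply: eq_bigr => h _; rewrite /= ReM_int.
Qed.

Definition convF (x : ZG G) (k h : G) (b : int) : int :=
  b * mcoeff (k * h^-1)%g x.
Lemma convF_zmod x k h : zmod_morphism (convF x k h).
Proof. by move=> b c; rewrite /convF mulrBl. Qed.
HB.instance Definition _ x k h :=
  GRing.isZmodMorphism.Build int int (convF x k h) (convF_zmod x k h).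

Lemma mcoeff_mul (x y : ZG G) k :
  mcoeff k (x * y) = \sum_(h <- msupp y) mcoeff h y * mcoeff (k * h^-1)%g x.
Proof.
rewrite -[RHS]/(malg_ext (convF x k) y).
elim/(@crossed_ind G (int_gring G)): y => [h m|y y' IHy IHy']; last first.
  by rewrite mulrDr mcoeffD raddfD /= IHy IHy'.
rewrite malg_extU /= /convF.
elim/(@crossed_ind G (int_gring G)): x => [g n|x x' IHx IHx']; last first.
  by rewrite mulrDl !mcoeffD mulrDr IHx IHx'.
rewrite crossed_mulUE !mcoeffU /= -(inj_eq (mulIg h^-1%g)) mulgK.
by rewrite mulrnAr mulrC.
Qed.

Definition row_cfun r (w : 'rV[ZG G]_r) (p : 'I_r * G) : R[i] :=
  (row_fun w p)%:C%C.

Lemma l2_row_cfun r (w : 'rV[ZG G]_r) : l2 (row_cfun w).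
Proof.
rewrite /l2 /= (esum_finite_support (row_supp_uniq w)) ?ltry// => p.
  by rewrite addr_ge0 ?sqr_ge0.
by move=> /row_fun_out ->; rewrite expr0n addr0.
Qed.

Lemma l2_mulmx_row_cfun r s (w : 'rV[ZG G]_r) (B : 'M[ZG G]_(r, s)) :
  l2_mulmx B (row_cfun w) = row_cfun (w *m B).
Proof.
apply/funext => -[j g]; rewrite /l2_mulmx /row_cfun /row_fun /= mxE.
rewrite !rmorph_int raddf_sum /= rmorph_sum; apply: eq_bigr => i _ /=.
rewrite mcoeff_mul rmorph_sum /=; apply: eq_bigr => h _.
by rewrite !rmorph_int intrM.
Qed.

Lemma l2_inner_row r (u : 'I_r * G -> R[i]) (w : 'rV[ZG G]_r) :
  Re (l2_inner u (row_cfun w)) = pairing (Re \o u) w.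
Proof.
have E p : Re (u p * (row_cfun w p)^*) = row_fun w p * Re (u p).
  by rewrite /row_cfun; case: (u p) => x y /=; rewrite oppr0 mulr0 subr0 mulrC.
rewrite /= (rsum_finite_support (row_supp_uniq w)).
  by rewrite pairingE; apply: eq_bigr => p _; rewrite E.
by move=> p pw; rewrite E row_fun_out// mul0r.
Qed.

End Pairing.

(** * Orthogonal projections of basis vectors in l2 *)

Section Projection.
Context {R : realType} {G : groupType}.
Local Notation tZ := (ZG_tracial R G).
Local Notation Re := (@complex.Re R).

Definition sqnorm (z : R[i]) : R := Re z ^+ 2 + complex.Im z ^+ 2.

Lemma sqnorm_ge0 z : 0 <= sqnorm z.
Proof. by rewrite addr_ge0 ?sqr_ge0. Qed.

Lemma l2_inner_unit r (u : 'I_r * G -> R[i]) i :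
  Re (l2_inner u (@l2_unit R G r i)) = Re (u (i, 1%g)).
Proof.
have E p : Re (u p * (@l2_unit R G r i p)^*) =
    if p == (i, 1%g) then Re (u p) else 0.
  rewrite /l2_unit; case: eqP => _; rewrite ?rmorph1 ?mulr1//.
  by rewrite rmorph0 mulr0.
rewrite /= (@rsum_finite_support _ _ _ [:: (i, 1%g)])//.
  by rewrite big_seq1 E eqxx.
by move=> p; rewrite mem_seq1 E => /negPf ->.
Qed.

Lemma l2_fin r (u : 'I_r * G -> R[i]) : l2 u ->
  (\esum_(p in [set: 'I_r * G]) (sqnorm (u p))%:E)%E \is a fin_num.
Proof.
move=> l2u; rewrite ge0_fin_numE ?esum_ge0// => p _.
by rewrite lee_fin sqnorm_ge0.
Qed.

(* Testing the defining property of the projection [u] of a basis vector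
   against [u] itself. *)
Lemma l2_proj_coordinate r (u : 'I_r * G -> R[i]) i : l2 u ->
  l2_inner (@l2_unit R G r i - u) u = 0 ->
  Re (u (i, 1%g)) = fine (\esum_(p in [set: 'I_r * G]) (sqnorm (u p))%:E).
Proof.
set c := Re (u (i, 1%g)) => l2u /(congr1 Re) /=.
(* The sign of c is not known in advance, so the term c at (i, 1) is split into positive and
   negative parts; [rsumB] then applies to f and g + |u|^2. *)
pose f (p : 'I_r * G) : R := if p == (i, 1%g) then Num.max c 0 else 0.
pose g (p : 'I_r * G) : R := (if p == (i, 1%g) then Num.max (- c) 0 else 0).
have f0 p : 0 <= f p by rewrite /f; case: ifP; rewrite // le_max lexx orbT.
have g0 p : 0 <= g p by rewrite /g; case: ifP; rewrite // le_max lexx orbT.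
have sf : \esum_(p in [set: 'I_r * G]) (f p)%:E = (Num.max c 0)%:E.
  rewrite (@esum_finite_support _ _ _ [:: (i, 1%g)])//.
    by rewrite big_seq1 /f eqxx.
  by move=> p; rewrite mem_seq1 /f => /negPf ->.
have sg : \esum_(p in [set: 'I_r * G]) (g p)%:E = (Num.max (- c) 0)%:E.
  rewrite (@esum_finite_support _ _ _ [:: (i, 1%g)])//.
    by rewrite big_seq1 /g eqxx.
  by move=> p; rewrite mem_seq1 /g => /negPf ->.
have su := l2_fin l2u.
have sgu : (\esum_(p in [set: 'I_r * G]) (g p + sqnorm (u p))%:E)%E =
    ((Num.max (- c) 0)%:E + \esum_(p in [set: 'I_r * G]) (sqnorm (u p))%:E)%E.
  by rewrite -sg -esumD// => p _; rewrite lee_fin ?sqnorm_ge0.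
have E p : Re ((@l2_unit R G r i - u) p * (u p)^*) = f p - (g p + sqnorm (u p)).
  rewrite -[(_ - u) p]/(@l2_unit R G r i p - u p) /l2_unit /f /g /sqnorm.
  case: eqP => [->|_].
    rewrite /c; case: (u _) => x y /=.
    by rewrite opprD addrA max0_sub; ring.
  by rewrite mulr0n sub0r; case: (u p) => x y /=; ring.
under eq_fun do rewrite E.
rewrite rsumB//.
- rewrite sf sgu fineD//= => h.
  by apply/eqP; rewrite -subr_eq0 -[X in X - _]max0_sub -addrA -opprD h.
- by move=> p; rewrite addr_ge0 ?sqnorm_ge0.
- by rewrite sf ltry.
- by rewrite sgu -(fineK su) -EFinD ltry.
Qed.

(** w pairs with V as M times the basis vector does, so w is at least as long as the projection of
    that multiple. The proof expands the square of M u - w on the support of w, u being the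
    projection of the basis vector. *)
Lemma l2_proj_le r (V : set ('I_r * G -> R[i])) i (M : R) (w : 'rV[ZG G]_r) :
  (forall u, V u -> l2 u) ->
  (forall u, V u -> pairing (Re \o u) w = M * Re (u (i, 1%g))) ->
  M ^+ 2 * Re (l2_inner (l2_proj V (@l2_unit R G r i)) (@l2_unit R G r i))
    <= sqn tZ w.
Proof.
move=> Vl2 Vw; rewrite l2_inner_unit /l2_proj.
(* Without a projection, [l2_proj] is 0 by default and so is the left side. *)
case: xgetP => [u _ [Vu uV]|_]; last by rewrite /= mulr0 sqn_ge0.
have cE := l2_proj_coordinate (Vl2 _ Vu) (uV _ Vu).
set c := Re _ in cE *.
pose s := row_supp w.
have le_c : \sum_(p <- s) Re (u p) ^+ 2 <= c.
  pose h (p : 'I_r * G) : R := if p \in s then Re (u p) ^+ 2 else 0.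
  have -> : \sum_(p <- s) Re (u p) ^+ 2 = \sum_(p <- s) h p.
    by apply: eq_big_seq => p ps; rewrite /h ps.
  rewrite cE -lee_fin fineK; last exact: l2_fin (Vl2 _ Vu).
  rewrite -(@esum_finite_support _ _ h s).
  - apply: le_esum => p _; rewrite lee_fin /h /sqnorm.
    by case: ifP => _; rewrite ?lerDl ?sqr_ge0// addr_ge0 ?sqr_ge0.
  - exact: row_supp_uniq.
  - by move=> p; rewrite /h; case: ifP; rewrite // sqr_ge0.
  - by move=> p /negPf ps; rewrite /h ps.
have := Vw _ Vu; rewrite pairingE -/s -/c => hw.
have : 0 <= \sum_(p <- s) (M * Re (u p) - row_fun w p) ^+ 2.
  by apply: sumr_ge0 => p _; exact: sqr_ge0.
rewrite sqn_row_supp -/s.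
have -> : \sum_(p <- s) (M * Re (u p) - row_fun w p) ^+ 2 =
    M ^+ 2 * (\sum_(p <- s) Re (u p) ^+ 2) -
    (M * \sum_(p <- s) row_fun w p * Re (u p)) *+ 2 +
    \sum_(p <- s) row_fun w p ^+ 2.
  rewrite !mulr_sumr -sumrMnl -sumrB -big_split; apply: eq_bigr => p _ /=.
  by ring.
rewrite hw => h; have := ler_wpM2l (sqr_ge0 M) le_c.
move: h; rewrite mulrA -expr2.
by set x := \sum_(_ <- _) _; set y := \sum_(_ <- _) _; lra.
Qed.

End Projection.

(** * The trace on [Linf] *)

Section LinfTrace.
Context {R : realType} {d : measure_display} {X : measurableType d}.
Variable mu : probability X R.

Definition int_real (f : X -> int) : X -> R := fun x => (f x)%:~R.

Lemma measurable_int_real (f : X -> int) :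
  int_measurable f -> measurable_fun [set: X] (int_real f).
Proof.
move=> mf _ B mB; rewrite setTI.
exact: (mf ((fun n : int => n%:~R : R) @^-1` B)).
Qed.

Lemma integrable_int_real (f : X -> int) :
  f \in Lmeas mu -> mu.-integrable [set: X] (EFin \o int_real f).
Proof.
move=> /LmeasP[mf [M fM]]; apply/integrableP; split.
  exact/measurable_EFinP/measurable_int_real.
apply: le_lt_trans (integral_le_bound (`|M|%:~R)%:E _ _ _ _) _ => //.
- exact/measurable_EFinP/measurable_int_real.
- move: fM; apply: filterS => x fM _ /=.
  by rewrite lee_fin /int_real -intr_norm ler_int (le_trans fM)// ler_norm.
- rewrite [X in (_ * X)%E](_ : _ = 1%E); last exact: probability_setT.
  by rewrite mule1 ltry.
Qed.

Definition Linf_int (a : Linf mu) : R :=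
  (\int[mu]_x int_real (Linf_rep a) x)%R.

Lemma Linf_int_of (f : X -> int) : f \in Lmeas mu ->
  Linf_int (Linf_of mu f) = (\int[mu]_x int_real f x)%R.
Proof.
move=> Lf; rewrite /Linf_int /Rintegral; congr fine.
have : {ae mu, forall x, Linf_rep (Linf_of mu f) x = f x}.
  by apply: Linf_of_ae; rewrite ?Linf_repP ?Linf_repK.
move=> fE; apply: ae_eq_integral => //.
- apply/measurable_EFinP/measurable_int_real.
  by case/LmeasP: (Linf_repP (Linf_of mu f)).
- by apply/measurable_EFinP/measurable_int_real; case/LmeasP: Lf.
- by move: fE; apply: filterS => x + _; rewrite /int_real => ->.
Qed.

Lemma Linf_int_zmod : zmod_morphism Linf_int.
Proof.
have addE : {morph Linf_int : a b / a + b}.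
  move=> a b; rewrite -[a]Linf_repK -[b]Linf_repK -Linf_ofD ?Linf_repP//.
  rewrite !Linf_int_of ?rpredD ?Linf_repP// -RintegralD//.
  - by apply: eq_Rintegral => x _; rewrite /int_real intrD.
  - exact/integrable_int_real/Linf_repP.
  - exact/integrable_int_real/Linf_repP.
by move=> a b; apply/eqP; rewrite eq_sym subr_eq -addE subrK.
Qed.

Lemma Linf_int_ge0 (f : X -> int) : f \in Lmeas mu ->
  {ae mu, forall x, 0 <= f x} -> 0 <= Linf_int (Linf_of mu f).
Proof.
move=> Lf f0.
(* An everywhere nonnegative representative of the same class. *)
have Lg : (fun x => `|f x|) \in Lmeas mu.
  have /LmeasP[mf [M fM]] := Lf; apply/LmeasP; split.
    by move=> B; exact: (mf [set n : int | B `|n|]).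
  by exists M; move: fM; apply: filterS => x; rewrite normr_id.
have -> : Linf_of mu f = Linf_of mu (fun x => `|f x|).
  apply: Linf_of_eq => //; move: f0; apply: filterS => x f0.
  by rewrite ger0_norm.
by rewrite Linf_int_of//; apply: Rintegral_ge0 => x _; rewrite ler0z.
Qed.

Lemma Linf_int_chi (B : set X) : measurable B ->
  \1_B \in Lmeas mu /\ (Linf_int (Linf_chi mu B))%:E = mu B.
Proof.
move=> mB.
have LB : (\1_B : X -> int) \in Lmeas mu.
  apply/LmeasP; split; last first.
    exists 1; apply: aeW => x; rewrite indicE.
    by case: (x \in B).
  move=> C; rewrite preimage_indic.
  by case: ifP => _; case: ifP => _ //; exact: measurableC.
split=> //; rewrite Linf_int_of// /Rintegral fineK.
  transitivity (\int[mu]_x (\1_B x)%:E)%E.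
    by apply: eq_integral => x _; rewrite /int_real !indicE; case: (x \in B).
  by rewrite integral_indic// setIT.
exact/integrable_fin_num/integrable_int_real.
Qed.

Lemma Linf_chi_idem (B : set X) : measurable B ->
  Linf_chi mu B * Linf_chi mu B = Linf_chi mu B.
Proof.
move=> /Linf_int_chi[LB _]; rewrite -Linf_ofM//; congr Linf_of.
by apply/funext => x; rewrite /GRing.mul /= indicE; case: (x \in B).
Qed.

Lemma Linf_int1 : Linf_int 1 = 1.
Proof.
rewrite -Linf_of1 Linf_int_of ?rpred1//.
rewrite /int_real Rintegral_cst// [X in _ * fine X](_ : _ = 1%E).
  by rewrite mulr1.
exact: probability_setT.
Qed.

Lemma Linf_int_bounded (a : Linf mu) : exists N : nat, forall b : Linf mu,
  Linf_int (b * b * (a * a)) <= N%:R * Linf_int (b * b).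
Proof.
have La := Linf_repP a; have /LmeasP[_ [M aM]] := La.
(* M bounds |a| almost everywhere, so M^2 b^2 - b^2 a^2 is nonnegative; [absz] turns M^2 into a
   natural number. *)
exists (absz (M * M)) => b; have Lb := Linf_repP b.
set u := Linf_rep a in La aM; set v := Linf_rep b in Lb.
have Lh : (v * v) *+ absz (M * M) - v * v * (u * u) \in Lmeas mu.
  by rewrite rpredB ?rpredMn ?rpredM.
have fMn (w : X -> int) n x : (w *+ n) x = w x *+ n.
  by elim: n => [|n IHn]; rewrite ?mulr0n// !mulrS -IHn.
have h0 : {ae mu, forall x, 0 <= ((v * v) *+ absz (M * M) - v * v * (u * u)) x}.
  move: aM; apply: filterS => x aM.
  rewrite -[X in _ <= X]/((v * v *+ _) x - v x * v x * (u x * u x)) fMn.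
  rewrite -mulr_natr -mulrBr mulr_ge0//; first exact: sqr_ge0.
  rewrite subr_ge0 natz abszE.
  rewrite -[u x * u x]expr2 -real_normK ?num_real// expr2.
  by rewrite normrM ler_pM// (le_trans aM)// ler_norm.
have := Linf_int_ge0 Lh h0; rewrite Linf_int_of//.
rewrite -[a]Linf_repK -[b]Linf_repK -!Linf_ofM ?rpredM//.
rewrite !Linf_int_of ?rpredM// => hge0; rewrite -subr_ge0.
have intv := integrable_int_real (rpredM Lb Lb).
have intvu := integrable_int_real (rpredM (rpredM Lb Lb) (rpredM La La)).
rewrite -RintegralZl// -RintegralB//; last first.
  exact: (integrableZl measurableT (absz (M * M))%:R intv).
move: hge0; congr (0 <= _); apply: eq_Rintegral => x _.
rewrite -[LHS]/((((v * v) *+ _) x - (v * v * (u * u)) x)%:~R) fMn intrB.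
rewrite [((_ *+ _)%:~R)]raddfMn /= -[LHS]/(_ *+ _ - _).
by rewrite -[_ *+ absz _]mulr_natl.
Qed.

Lemma Linf_int_sqr_ge0 (a : Linf mu) : 0 <= Linf_int (a * a).
Proof.
rewrite -[a]Linf_repK -Linf_ofM ?Linf_repP// Linf_int_ge0 ?rpredM ?Linf_repP//.
by apply: aeW => x; exact: sqr_ge0.
Qed.

End LinfTrace.

Section ActionTrace.
Context {R : realType} {G : groupType} {d : measure_display}
  {X : measurableType d} {mu : probability X R}.
Variable alpha : standard_action G mu.

Lemma Linf_int_act g a : Linf_int (Linf_act alpha g a) = Linf_int a.
Proof.
have Lf := Linf_repP a; rewrite -[a in LHS]Linf_repK Linf_act_of//.
rewrite Linf_int_of; last exact: Lmeas_sact.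
rewrite /Linf_int /Rintegral; congr fine.
have mg := sact_measurable alpha (g^-1)%g.
transitivity (\int[pushforward mu (alpha (g^-1)%g)]_x
    (int_real (Linf_rep a) x)%:E)%E.
  rewrite integral_pushforward//.
    by apply/measurable_EFinP/measurable_int_real; case/LmeasP: Lf.
  exact: (integrable_int_real (Lmeas_sact alpha (g^-1)%g Lf)).
apply: eq_measure_integral => B mB _.
by rewrite /pushforward; exact: sact_pmp.
Qed.

Definition Linf_trace : invariant_trace R (Linf_gring alpha) :=
  @InvariantTrace R G (Linf_gring alpha) (@Linf_int R d X mu)
    (@Linf_int_zmod R d X mu) Linf_int_act (@Linf_int_sqr_ge0 R d X mu)
    (@Linf_int_bounded R d X mu).

End ActionTrace.

(** * Exactness of the induced complex *)

Definition torsion_free (V : zmodType) : Prop :=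
  forall (x : V) (n : int), x *~ n = 0 -> n = 0 \/ x = 0.

Section TorsionFree.
Variable V : zmodType.
Hypothesis tfV : torsion_free V.

Definition int_independent k (c : 'I_k -> V) : Prop :=
  forall n : 'rV[int]_k, \sum_j c j *~ n 0 j = 0 -> n = 0.

Definition int_comb k (c : 'I_k -> V) p (B : 'M[int]_(p, k)) (i : 'I_p) : V :=
  \sum_j c j *~ B i j.

Lemma int_combM k (c : 'I_k -> V) p q (A : 'M[int]_(p, q))
    (B : 'M[int]_(q, k)) i :
  int_comb (int_comb c B) A i = int_comb c (A *m B) i.
Proof.
rewrite /int_comb; under eq_bigr do rewrite mulrz_suml.
rewrite exchange_big; apply: eq_bigr => j _ /=.
rewrite mxE mulrz_sumr; apply: eq_bigr => l _.
by rewrite -mulrzA mulrC.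
Qed.

Lemma int_comb1 k (c : 'I_k -> V) i : int_comb c 1%:M i = c i.
Proof.
rewrite /int_comb (bigD1 i)//= big1 ?addr0 => [|j ji]; rewrite mxE.
  by rewrite eqxx mulr1z.
by rewrite eq_sym (negPf ji) mulr0z.
Qed.

(* A relation among the generators becomes, after a unimodular change of
   generators (Smith form of a row), the vanishing of a multiple of one of
   them, which can then be dropped. *)
Lemma torsion_free_span (T : Type) k (c : 'I_k -> V) (B : T -> 'rV[int]_k) :
  exists k' (c' : 'I_k' -> V) (B' : T -> 'rV[int]_k'), int_independent c' /\
    forall x, int_comb c (B x) 0 = int_comb c' (B' x) 0.
Proof.
elim: k c B => [|k IHk] c B.
  by exists 0%N, c, B; split=> // n _; apply/rowP => -[].
have [|/existsNP[n /not_implyP[nc0 n0]]] := pselect (int_independent c).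
  by move=> ci; exists k.+1, c, B.
have [L Lu [U Uu [s _ nE]]] := int_Smith_normal_form n.
pose c1 := int_comb c U.
have c10 : c1 ord0 = 0.
  have : int_comb c n 0 = 0 by exact: nc0.
  rewrite {1}nE -int_combM -/c1 /int_comb big_ord_recl big1 ?addr0; last first.
    move=> j _; rewrite mxE big_ord1 mxE /= mulr0n mulr0.
    exact: mulr0z.
  case/tfV => // h; case: n0; rewrite nE.
  rewrite (_ : L *m _ = 0) ?mul0mx//; apply/rowP => j; rewrite [RHS]mxE.
  case: (unliftP ord0 j) => [j' ->|->//].
  by rewrite mxE big_ord1 mxE /= mulr0n mulr0.
have [k' [c' [B' [c'i cB']]]] := IHk (c1 \o lift ord0)
  (fun x => col' ord0 (B x *m invmx U)).
exists k', c', B'; split=> // x; rewrite -cB'.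
have -> : int_comb c (B x) 0 = int_comb c1 (B x *m invmx U) 0.
  by rewrite int_combM mulmxKV.
rewrite /int_comb big_ord_recl c10 mul0rz add0r; apply: eq_bigr => j _.
by rewrite [in RHS]mxE.
Qed.

End TorsionFree.

Section Decompose.
Context {G : groupType} {A : gring G}.
Hypothesis tfA : torsion_free A.
Local Notation R := (crossed A).
Local Notation incl := (@ZG_incl G A).

Definition scal (a : A) : R := mkmalgU 1%g a.

Lemma mcoeff_scal_mul a (x : R) g : mcoeff g (scal a * x) = a * mcoeff g x.
Proof.
elim/(@crossed_ind G A): x => [h b|x x' IHx IHx']; last first.
  by rewrite mulrDr !mcoeffD IHx IHx' mulrDr.
by rewrite crossed_mulUE mul1g gact_one !mcoeffU mulrnAr.
Qed.

Lemma mcoeff_incl (x : ZG G) g : mcoeff g (incl x) = (mcoeff g x)%:~R.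
Proof.
elim/(@crossed_ind G (int_gring G)): x => [h n|x x' IHx IHx']; last first.
  by rewrite raddfD !mcoeffD /= IHx IHx' intrD.
by rewrite ZG_inclU !mcoeffU; case: eqP.
Qed.

Lemma crossed_act_incl (x : ZG G) (n : int) :
  crossed_act (incl x) (n%:~R : A) = (crossed_act x n : int)%:~R.
Proof.
elim/(@crossed_ind G (int_gring G)): x => [h m|x x' IHx IHx']; last first.
  by rewrite raddfD !crossed_actDl /= IHx IHx' intrD.
by rewrite ZG_inclU !crossed_actU gact_int intrM.
Qed.

(** The coefficient at each g is an integral relation among the c j. *)
Lemma independent_incl k (c : 'I_k -> A) (z : 'I_k -> ZG G) :
  int_independent c -> \sum_j scal (c j) * incl (z j) = 0 -> forall j, z j = 0.
Proof.
move=> ci cz j; apply/malgP => g; rewrite mcoeff0.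
have /rowP/(_ j) : \row_j mcoeff g (z j) = 0 :> 'rV[int]_k.
  apply: ci; have := congr1 (mcoeff g) cz; rewrite raddf_sum mcoeff0 /= => h.
  rewrite -[RHS]h; apply: eq_bigr => i _.
  by rewrite mcoeff_scal_mul mcoeff_incl mxE mulrzr.
by rewrite !mxE.
Qed.

(** The finitely many coefficients of v span a finitely generated subgroup of the torsion-free A,
    which is free; expanding them in a basis c writes v with rows over the group ring. With
    [independent_incl], this is an elementwise form of flatness of R over the group ring. *)
Lemma crossed_decompose r (v : 'rV[R]_r) :
  exists k (c : 'I_k -> A) (y : 'I_k -> 'rV[ZG G]_r),
    int_independent c /\
    v = \sum_j scal (c j) *: map_mx incl (y j).
Proof.
pose d := (\big[fsetU/fset0]_i msupp (v 0 i))%fset.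
have dP i : (msupp (v 0 i) `<=` d)%fset.
  exact: (bigfcup_sup (fun i => msupp (v 0 i)) (mem_index_enum i)).
pose T := ('I_r * d)%type.
(* [c0] lists all coefficients of v, and the row of the identity matrix picks out one of them. *)
pose c0 (t : 'I_#|{: T}|) : A :=
  mcoeff (val (enum_val t).2) (v 0 (enum_val t).1).
have [k [c [B [ci cB]]]] := torsion_free_span tfA c0
  (fun t : T => row (enum_rank t) 1%:M).
exists k, c, (fun j =>
  \row_i \sum_(g : d) (mkmalgU (val g) (B (i, g) 0 j) : ZG G)).
split=> //; apply/rowP => i; rewrite summxE.
have -> : v 0 i = \sum_(g : d) (mkmalgU (val g) (mcoeff (val g) (v 0 i)) : R).
  rewrite -(big_seq_fsetE +%R d xpredT
    (fun g => mkmalgU g (mcoeff g (v 0 i)) : R)) [LHS]monalgE /=.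
  apply: big_fset_incl => // g _ gv.
  by rewrite mcoeff_outdom// monalgU0.
under [RHS]eq_bigr => j _ do rewrite !mxE raddf_sum /= mulr_sumr.
rewrite exchange_big; apply: eq_bigr => g _ /=.
have -> : mcoeff (val g) (v 0 i) = \sum_j c j *~ B (i, g) 0 j.
  rewrite -[RHS]/(int_comb c (B (i, g)) 0) -cB.
  have -> : int_comb c0 (row (enum_rank (i, g)) 1%:M) 0 = c0 (enum_rank (i, g)).
    by rewrite -[RHS]int_comb1 /int_comb; apply: eq_bigr => l _; rewrite mxE.
  by rewrite /c0 enum_rankK.
rewrite raddf_sum /=; apply: eq_bigr => j _.
rewrite ZG_inclU crossed_mulUE mul1g gact_one.
by rewrite mulrzr.
Qed.

End Decompose.

(** * Row vectors and cycles in based complexes *)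

Section Combinations.
Context {S : nzRingType}.

Definition comb (M : lmodType S) r (v : 'rV[S]_r) (b : 'I_r -> M) : M :=
  \sum_i v 0 i *: b i.

Section Comb.
Context {M : lmodType S} {r : nat}.
Implicit Types (v w : 'rV[S]_r) (b : 'I_r -> M).

Lemma combD v w b : comb (v + w) b = comb v b + comb w b.
Proof.
by rewrite /comb -big_split; apply: eq_bigr => i _; rewrite mxE scalerDl.
Qed.

Lemma combZ a v b : comb (a *: v) b = a *: comb v b.
Proof.
by rewrite /comb scaler_sumr; apply: eq_bigr => i _; rewrite mxE scalerA.
Qed.

Lemma comb0 b : comb 0 b = 0.
Proof. by rewrite /comb big1// => i _; rewrite mxE scale0r. Qed.

Lemma combB v w b : comb (v - w) b = comb v b - comb w b.
Proof. by rewrite combD -[- w]scaleN1r combZ scaleN1r. Qed.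

Lemma comb_sum (I : Type) (s : seq I) (F : I -> 'rV[S]_r) b :
  comb (\sum_(i <- s) F i) b = \sum_(i <- s) comb (F i) b.
Proof.
by elim/big_rec2: _ => [|i _ x _ <-]; [exact: comb0|exact: combD].
Qed.

Lemma comb_delta i b : comb (delta_mx 0 i) b = b i.
Proof.
rewrite /comb (bigD1 i)//= big1 ?addr0 => [|j ji]; rewrite mxE.
  by rewrite !eqxx scale1r.
by rewrite (negPf ji) andbF scale0r.
Qed.

Lemma comb_mul s (v : 'rV[S]_s) (B : 'M[S]_(s, r)) b :
  comb (v *m B) b = comb v (fun i => comb (row i B) b).
Proof.
rewrite /comb; under eq_bigr do rewrite mxE scaler_suml.
rewrite exchange_big; apply: eq_bigr => i _ /=; rewrite scaler_sumr.
by apply: eq_bigr => j _; rewrite mxE scalerA.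
Qed.

Lemma eq_comb v b b' : b =1 b' -> comb v b = comb v b'.
Proof. by move=> bb'; apply: eq_bigr => i _; rewrite bb'. Qed.

Lemma comb_linear (N : lmodType S) (f : {linear M -> N}) v b :
  f (comb v b) = comb v (f \o b).
Proof. by rewrite raddf_sum; apply: eq_bigr => i _ /=; rewrite linearZ. Qed.

Lemma is_basis_span b x : is_basis b -> exists v, x = comb v b.
Proof.
case=> + _ => /(_ x)[s [c ->]].
exists (\sum_(i <- s) c i *: delta_mx 0 i); rewrite comb_sum.
by apply: eq_bigr => i _; rewrite combZ comb_delta.
Qed.

Lemma is_basis_free b v : is_basis b -> comb v b = 0 -> v = 0.
Proof.
case=> _ free v0; apply/rowP => i; rewrite [RHS]mxE.
apply: (free (enum 'I_r) (fun i => v 0 i)); rewrite ?enum_uniq ?mem_enum//.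
by rewrite big_enum.
Qed.

Lemma is_basis_combI b v w : is_basis b -> comb v b = comb w b -> v = w.
Proof.
move=> bb vw; apply/eqP; rewrite -subr_eq0; apply/eqP.
by apply: (is_basis_free bb); rewrite combB vw subrr.
Qed.

End Comb.

(** The augmentation serves as the boundary in degree 0, so that exactness has one form in all
    degrees. *)
Definition is_cycle (L : lmodType S) (C : aug_complex L) (k : nat) :
    C k -> Prop :=
  match k with
  | 0 => fun x => aug C x = 0
  | j.+1 => fun x => bd C j x = 0
  end.

Lemma is_cycle_bd (L : lmodType S) (C : aug_complex L) k (x : C k.+1) :
  is_cycle (bd C k x).
Proof. by case: k x => [|k] x /=; rewrite ?aug_bd ?bd_bd. Qed.

Lemma resolution_exact (L : lmodType S) (C : aug_complex L) k (x : C k) :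
  resolution C -> is_cycle x -> exists y, bd C k y = x.
Proof. by case=> _ ex0 exS; case: k x => [|k] x; [exact: ex0|exact: exS]. Qed.

(** Matrices stand for maps out of free modules: the images of the basis vectors, which are the
    rows, are chosen independently. *)
Lemma rows_choice p q (P : 'I_p -> 'rV[S]_q -> Prop) :
  (forall i, exists v, P i v) ->
  exists B : 'M[S]_(p, q), forall i, P i (row i B).
Proof.
move=> /choice[f fP]; exists (\matrix_i f i) => i.
by rewrite rowK.
Qed.

End Combinations.

Section BasedResolution.
Context {S : nzRingType} {L : lmodType S} {C : aug_complex L} {m : nat}.
Context {rk : nat -> nat} {e : forall k, 'I_(rk k) -> C k}.
Context {B : forall k, 'M[S]_(rk k.+1, rk k)}.
Hypothesis exact_C : resolution C.
Hypothesis basis_e : forall k, (k <= m.+1)%N -> is_basis (@e k).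
Hypothesis bd_e : forall k, (k <= m)%N -> forall i,
  bd C k (e i) = \sum_j B k i j *: e j.

Lemma bd_comb k v : (k <= m)%N ->
  bd C k (comb v (@e k.+1)) = comb (v *m B k) (@e k).
Proof.
move=> km; rewrite comb_linear comb_mul; apply: eq_comb => i /=.
by rewrite bd_e//; apply: eq_bigr => j _; rewrite mxE.
Qed.

Lemma bd_matrix0 k : (k < m)%N -> B k.+1 *m B k = 0.
Proof.
move=> km; apply/row_matrixP => i; rewrite row0.
apply: (is_basis_free (basis_e (leqW (ltnW km)))).
rewrite row_mul -(bd_comb _ (ltnW km)).
rewrite (_ : comb _ _ = bd C k.+1 (e i)) ?bd_bd// bd_e//.
by apply: eq_bigr => j _; rewrite mxE.
Qed.

Lemma based_exact k v : (k <= m)%N -> is_cycle (comb v (@e k)) ->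
  exists w, v = w *m B k.
Proof.
move=> km /(resolution_exact exact_C)[y yv].
have [w yw] := is_basis_span y (basis_e (km : (k.+1 <= m.+1)%N)).
exists w; apply: (is_basis_combI (basis_e (leqW km))).
by rewrite -bd_comb// -yw.
Qed.

End BasedResolution.

Section Induced.
Context {G : groupType} {A : gring G}.
Hypothesis tfA : torsion_free A.
Local Notation R := (crossed A).
Local Notation incl := (@ZG_incl G A).
Context {C : aug_complex (Ztriv G)} {m : nat}.
Context {rk : nat -> nat} {e : forall k, 'I_(rk k) -> C k}.
Context {B : forall k, 'M[ZG G]_(rk k.+1, rk k)}.
Hypothesis exact_C : resolution C.
Hypothesis basis_e : forall k, (k <= m.+1)%N -> is_basis (@e k).
Hypothesis bd_e : forall k, (k <= m)%N -> forall i,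
  bd C k (e i) = \sum_j B k i j *: e j.

Definition ibd k : 'M[R]_(rk k.+1, rk k) := map_mx incl (B k).

(** The augmentation of the induced complex in coordinates: each basis element goes to its integral
    augmentation, viewed as a constant. *)
Definition iaug (v : 'rV[R]_(rk 0)) : base_mod A :=
  comb v (fun i => (aug C (e i) : int)%:~R : base_mod A).

Definition icycle k : 'rV[R]_(rk k) -> Prop :=
  match k with
  | 0 => fun v => iaug v = 0
  | j.+1 => fun v => v *m ibd j = 0
  end.

Lemma iaug_map (y : 'rV[ZG G]_(rk 0)) :
  iaug (map_mx incl y) = (aug C (comb y (@e 0)) : int)%:~R.
Proof.
rewrite comb_linear /iaug /comb (raddf_sum (intr : int -> A)).
apply: eq_bigr => i _; rewrite mxE.
exact: (crossed_act_incl (y 0 i) (aug C (e i))).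
Qed.

Lemma iaug_surj : forall a, exists v, iaug v = a.
Proof.
move=> a; have [surj _ _] := exact_C.
have [x x1] := surj (1 : int).
have [y xy] := is_basis_span x (basis_e (leq0n _)).
exists (scal a *: map_mx incl y).
rewrite /iaug combZ -/(iaug _) iaug_map -xy x1.
by rewrite /GRing.scale /= crossed_actU gact1 mulr1.
Qed.

(** Decompose v along independent coefficients c. Independence makes each group ring component a
    cycle of C; these are boundaries, and the lifts are recombined with the same c. *)
Lemma induced_exact k v : (k <= m)%N -> icycle v ->
  exists w, v = w *m ibd k.
Proof.
move=> km v0; have [l [c [y [ci vE]]]] := crossed_decompose tfA v.
have yc j : is_cycle (comb (y j) (@e k)).
  case: k v y km v0 vE => [|k] v y km v0 vE /=.
    suff /rowP/(_ j) : \row_j (aug C (comb (y j) (@e 0)) : int) = 0.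
      by rewrite !mxE.
    apply: ci; rewrite -[RHS]v0 vE /iaug comb_sum; apply: eq_bigr => i _.
    rewrite combZ -/(iaug _) iaug_map mxE.
    by rewrite [RHS]crossed_actU gact_int mulrzr.
  rewrite (bd_comb bd_e (y j) (ltnW km)).
  suff -> : y j *m B k = 0 by rewrite comb0.
  apply/rowP => i; rewrite [RHS]mxE.
  apply: (independent_incl ci (z := fun j => (y j *m B k) 0 i)).
  have /rowP/(_ i) := v0; rewrite vE mulmx_suml summxE mxE => h.
  rewrite -[RHS]h; apply: eq_bigr => j' _.
  by rewrite -scalemxAl -map_mxM !mxE.
have [w yw] := choice (fun j => based_exact exact_C basis_e bd_e km (yc j)).
exists (\sum_j scal (c j) *: map_mx incl (w j)).
rewrite vE mulmx_suml; apply: eq_bigr => j _.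
by rewrite -scalemxAl -map_mxM -yw.
Qed.

Lemma ibd0 k : (k < m)%N -> ibd k.+1 *m ibd k = 0.
Proof. by move=> km; rewrite -map_mxM (bd_matrix0 basis_e bd_e)// map_mx0. Qed.

End Induced.

(** * Factoring the identity through the marked complex up to homotopy *)

Section Retract.
Context {G : groupType} {A : gring G}.
Hypothesis tfA : torsion_free A.
Local Notation R := (crossed A).
Local Notation incl := (@ZG_incl G A).
Context {C C2 : aug_complex (Ztriv G)} {m : nat}.
Context {rk : nat -> nat} {e : forall k, 'I_(rk k) -> C k}.
Context {B : forall k, 'M[ZG G]_(rk k.+1, rk k)}.
Hypothesis exact_C : resolution C.
Hypothesis basis_e : forall k, (k <= m.+1)%N -> is_basis (@e k).
Hypothesis bd_e : forall k, (k <= m)%N -> forall i,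
  bd C k (e i) = \sum_j B k i j *: e j.
Hypothesis exact_C2 : resolution C2.
Context {D : aug_complex (base_mod A)} {s : nat -> nat}.
Context {co : forall k, {linear D k -> 'rV[R]_(s k)}}.
Context {gen : forall k, 'I_(s k) -> D k}.
Hypothesis coK : forall k x, comb (co k x) (@gen k) = x.
Context {f : forall k, {linear C2 k -> D k | @ZG_incl G A \; *:%R}}.
Hypothesis aug_f : forall x, aug D (f 0%N x) = (aug C2 x : int)%:~R.
Hypothesis bd_f : forall k, (k <= m)%N -> forall x,
  bd D k (f k.+1 x) = f k (bd C2 k x).
Local Notation ibd := (ibd (A := A) (B := B)).
Local Notation iaug := (iaug (A := A) (e := e)).
Local Notation icycle := (icycle (A := A) (e := e) (B := B)).

(* The contribution of the homotopy in the previous degree. *)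
Definition from_prev k : 'M[R]_(rk k) -> Prop :=
  match k with
  | 0 => fun W => W = 0
  | j.+1 => fun W => exists Z, W = ibd j *m Z
  end.

(** Matrices act on rows from the right: u gives a map from C to C2, which f carries on to D, Y a
    map from D k back to the induced module, and H, W the homotopy. On cycles only their
    preservation is recorded, which is what the next degree uses. As [co] and [gen] form a dual
    basis of D k, Y can be chosen one generator at a time. *)
Definition retract_at k : Prop :=
  exists (u : 'I_(rk k) -> C2 k) (Y : 'M[R]_(s k, rk k))
    (H : 'M[R]_(rk k, rk k.+1)) (W : 'M[R]_(rk k)),
  [/\ forall y, is_cycle (comb y (@e k)) -> is_cycle (comb y u),
      forall x, is_cycle x -> icycle (co k x *m Y),
      1%:M = (\matrix_i co k (f k (u i))) *m Y + H *m ibd k + W &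
      from_prev W].

Lemma ibd_prev k (W : 'M[R]_(rk k)) : (k < m)%N -> from_prev W ->
  ibd k *m W = 0.
Proof.
case: k W => [|k] W km /=; first by move=> ->; rewrite mulmx0.
move=> [Z ->]; rewrite mulmxA (ibd0 basis_e bd_e) ?mul0mx//.
exact: ltnW.
Qed.

Lemma f_comb k r (y : 'rV[ZG G]_r) (u : 'I_r -> C2 k) :
  f k (comb y u) = comb (map_mx incl y) (f k \o u).
Proof.
by rewrite raddf_sum; apply: eq_bigr => i _ /=; rewrite linearZ mxE.
Qed.

Lemma co_mul k r (x : D k) (Y : 'M[R]_(s k, r)) :
  co k x *m Y = comb (co k x) (fun i => row i Y).
Proof. by rewrite mulmx_sum_row. Qed.

(** Both u and Y lift given values through surjective augmentations, so the composite preserves the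
    augmentation and differs from the identity by a boundary. *)
Lemma retract0 : retract_at 0.
Proof.
have [surj _ _] := exact_C2.
have [u uE] := choice (fun i : 'I_(rk 0) => surj (aug C (e i))).
have [Y YE] := rows_choice
  (fun i => iaug_surj exact_C basis_e (aug D (@gen 0 i))).
have cY x : iaug (co 0 x *m Y) = aug D x.
  rewrite co_mul /iaug -[in RHS](coK x) comb_linear.
  rewrite comb_sum; apply: eq_bigr => i _.
  by rewrite combZ /= -YE.
pose Phi := \matrix_i co 0 (f 0 (u i)).
have Ecyc i : icycle (row i (1%:M - Phi *m Y)).
  rewrite /= /iaug linearB /= combB row_mul rowK.
  rewrite -/(iaug (co 0 _ *m Y)) cY aug_f uE row1 comb_delta.
  by rewrite subrr.
have [H HE] := rows_choice (fun i =>
  induced_exact tfA exact_C basis_e bd_e (leq0n m) (Ecyc i)).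
exists u, Y, H, 0; split=> //=.
- move=> y; rewrite !comb_linear => <-; apply: eq_comb => i /=.
  exact: uE.
- by move=> x; rewrite cY.
- rewrite addr0 addrC; apply/eqP; rewrite -subr_eq; apply/eqP.
  by apply/row_matrixP => i; rewrite row_mul -HE.
Qed.

(** The comparison argument for resolutions: u, Y and H are lifted along exact complexes, one
    generator at a time, and the new W is [ibd k *m H]. *)
Lemma retractS k : (k < m)%N -> retract_at k -> retract_at k.+1.
Proof.
move=> km [u [Y [H [W [cu cY HW prevW]]]]].
have u_lift i : exists w, bd C2 k w = comb (row i (B k)) u.
  apply: (resolution_exact exact_C2); apply: cu.
  suff -> : comb (row i (B k)) (@e k) = bd C k (e i) by exact: is_cycle_bd.
  by rewrite (bd_e (ltnW km)); apply: eq_bigr => j _; rewrite mxE.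
have [u' u'E] := choice u_lift.
have Y_lift i : exists v, co k (bd D k (@gen k.+1 i)) *m Y = v *m ibd k.
  apply: (induced_exact tfA exact_C basis_e bd_e (ltnW km)).
  by apply: cY; exact: is_cycle_bd.
have [Y' Y'E] := rows_choice Y_lift.
have cY' x : co k.+1 x *m Y' *m ibd k = co k (bd D k x) *m Y.
  rewrite co_mul -[in RHS](coK x) comb_linear comb_linear.
  rewrite /comb !mulmx_suml; apply: eq_bigr => i _.
  by rewrite -!scalemxAl Y'E.
pose Phi := \matrix_i co k (f k (u i)).
pose Phi' := \matrix_i co k.+1 (f k.+1 (u' i)).
have PhiE : Phi' *m Y' *m ibd k = ibd k *m (Phi *m Y).
  apply/row_matrixP => i; rewrite !row_mul rowK cY' (bd_f (ltnW km)) u'E f_comb.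
  rewrite comb_linear mulmxA; congr (_ *m _).
  rewrite mulmx_sum_row map_row; apply: eq_bigr => j _.
  by rewrite rowK.
(* By the homotopy identity in degree k the left side is [ibd k *m W], and W is 0 or starts with the
   previous boundary. *)
have E0 : (1%:M - Phi' *m Y' - ibd k *m H) *m ibd k = 0.
  transitivity (ibd k *m (1%:M - Phi *m Y - H *m ibd k)).
    by rewrite !mulmxBl !mulmxBr mul1mx mulmx1 PhiE !mulmxA.
  have -> : 1%:M - Phi *m Y - H *m ibd k = W.
    by rewrite HW -/Phi -addrA -opprD addrC addKr.
  exact: ibd_prev.
have H_lift i : exists v,
    row i (1%:M - Phi' *m Y' - ibd k *m H) = v *m ibd k.+1.
  apply: (induced_exact tfA exact_C basis_e bd_e km).
  by rewrite /= -row_mul E0 row0.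
have [H' H'E] := rows_choice H_lift.
exists u', Y', H', (ibd k *m H); split.
- move=> y /=; rewrite (bd_comb bd_e _ (ltnW km)).
  move=> /(is_basis_free (basis_e (leqW (ltnW km)))) yB.
  rewrite comb_linear (eq_comb _ (b' := fun i => comb (row i (B k)) u))//.
  by rewrite -comb_mul yB comb0.
- by move=> x /= x0; rewrite cY' x0 raddf0 mul0mx.
- have <- : 1%:M - Phi' *m Y' - ibd k *m H = H' *m ibd k.+1.
    by apply/row_matrixP => i; rewrite row_mul -H'E.
  by rewrite -/Phi' -addrA subrK addrC subrK.
- by exists H.
Qed.

Lemma retract k : (k <= m)%N -> retract_at k.
Proof.
elim: k => [|k IHk] km; first exact: retract0.
by apply: retractS => //; apply: IHk; exact: ltnW.
Qed.

End Retract.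

Section LinfTorsion.
Context {R : realType} {d : measure_display} {X : measurableType d}.
Variable mu : probability X R.

Lemma Linf_of0 : Linf_of mu 0 = 0.
Proof.
by apply: (addrI (Linf_of mu 0)); rewrite -Linf_ofD ?rpred0// !addr0.
Qed.

Lemma Linf_ofMn f n : f \in Lmeas mu -> Linf_of mu (f *+ n) = Linf_of mu f *+ n.
Proof.
move=> Lf; elim: n => [|n IHn]; first by rewrite !mulr0n Linf_of0.
by rewrite !mulrS Linf_ofD ?rpredMn// IHn.
Qed.

Lemma Linf_torsion_free : torsion_free (Linf mu).
Proof.
move=> a n.
have torsion_nat k : a *+ k.+1 = 0 -> a = 0.
  have La := Linf_repP a; rewrite -[a]Linf_repK -Linf_ofMn// -Linf_of0 => a0.
  apply: Linf_of_eq; rewrite ?rpred0//.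
  have := Linf_of_ae (rpredMn _ La) (rpred0 _) a0; apply: filterS => x.
  have -> : (Linf_rep a *+ k.+1) x = Linf_rep a x *+ k.+1.
    by elim: k.+1 => [|j IHj]; rewrite ?mulr0n// !mulrS -IHj.
  by move/eqP; rewrite mulrn_eq0 => /eqP.
case: n => [[|k]|k]; [by left| |].
  by rewrite -pmulrn => /torsion_nat; right.
rewrite NegzE mulrNz => /eqP; rewrite oppr_eq0 -pmulrn => /eqP/torsion_nat.
by right.
Qed.

End LinfTorsion.

(** * Von Neumann dimension against damped powers of the Laplacian *)

Section VonNeumann.
Context {R : realType} {G : groupType}.
Local Notation tZ := (ZG_tracial R G).
Local Notation Re := (@complex.Re R).

Lemma pairing_delta r (u : 'I_r * G -> R[i]) i :
  pairing (Re \o u) (delta_mx 0 i) = Re (u (i, 1%g)).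
Proof.
rewrite -[delta_mx 0 i]scale1r -[1]/(mkmalgU 1%g (1 : int)) pairing_single.
by rewrite mul1r.
Qed.

(** V is orthogonal to the image of the Laplacian [a *m adj tZ a], so row i of the k-th power pairs
    with V as N^k times the basis vector i does; [l2_proj_le] is then summed over i. *)
Lemma vN_dim_le r l (V : set ('I_r * G -> R[i])) (a : 'M[ZG G]_(r, l)) N k :
  (forall u, V u -> l2 u) ->
  (forall u, V u -> forall w, pairing (Re \o u) (w *m a *m adj tZ a) = 0) ->
  (N%:R ^+ k) ^+ 2 * vN_dim V <= sqn tZ (damp tZ N a ^+ k).
Proof.
move=> Vl2 Va; rewrite /vN_dim mulr_sumr.
have -> : sqn tZ (damp tZ N a ^+ k) = \sum_i sqn tZ (row i (damp tZ N a ^+ k)).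
  rewrite sqnE; apply: eq_bigr => i _; rewrite sqnE big_ord1.
  by apply: eq_bigr => j _; rewrite mxE.
apply: ler_sum => i _; apply: l2_proj_le => // u Vu.
elim: k => [|k IHk]; first by rewrite expr0 row1 pairing_delta mul1r.
rewrite exprSr -mulmxE row_mul mul_damp raddfB /= Va// subr0 raddfMn /= IHk.
by rewrite exprSr -mulr_natl; ring.
Qed.

Context {rk : nat -> nat} {A : forall k, 'M[ZG G]_(rk k.+1, rk k)}.

Lemma pairing_cycle n s (B : 'M[ZG G]_(rk n, s)) (u : 'I_(rk n) * G -> R[i])
    (w : 'rV[ZG G]_s) :
  l2_mulmx B u = 0 -> pairing (Re \o u) (w *m adj tZ B) = 0.
Proof.
move=> Bu; rewrite pairing_mul_adj Bu /pairing big1// => i _.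
rewrite /malg_ext big1// => g _.
by rewrite /= /pairF /= mulr0.
Qed.

Lemma pairing_boundary n (u : 'I_(rk n) * G -> R[i]) (w : 'rV[ZG G]_(rk n.+1)) :
  (forall v, l2 v -> l2_inner u (l2_mulmx (A n) v) = 0) ->
  pairing (Re \o u) (w *m A n) = 0.
Proof.
move=> uA; rewrite -l2_inner_row -l2_mulmx_row_cfun uA//.
exact: l2_row_cfun.
Qed.

End VonNeumann.

Lemma adj_row_mx (F : realDomainType) (S : nzRingType) (t : tracial F S) p q r
    (x : 'M[S]_(p, q)) (y : 'M[S]_(p, r)) :
  adj t (row_mx x y) = col_mx (adj t x) (adj t y).
Proof.
by apply/matrixP => i j; rewrite !mxE; case: (splitP i) => k _; rewrite mxE.
Qed.

(** * Marked modules as images of projections, and the bound for one embedding *)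

Section MarkedModules.
Context {R : realType} {G : groupType} {d : measure_display}
  {X : measurableType d} {mu : probability X R}.
Variable alpha : standard_action G mu.
Local Notation RR := (Linf_crossed alpha).
Local Notation tR := (crossed_tracial (Linf_trace alpha)).
Local Notation chi S := (scal (Linf_chi mu S : Linf_gring alpha)).

Lemma chi_idem (S : set X) : measurable S -> (chi S : RR) * chi S = chi S.
Proof.
move=> mS; rewrite crossed_mulUE mulg1 gact_one; congr mkmalgU.
exact: Linf_chi_idem.
Qed.

Lemma cyclic_chi_mul (S : set X) (x : RR) : measurable S ->
  @cyclic_chi _ _ _ _ _ alpha S x -> x * chi S = x.
Proof. by move=> mS [y ->]; rewrite -mulrA chi_idem. Qed.

Section Marking.
Context {M : lmodType RR} (m : marking M).
Local Notation s := (mk_rank m).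

(** The projection chi: [mk_iso] identifies the marked module with the image of right multiplication
    by this diagonal idempotent. *)
Definition mark_mx : 'M[RR]_s :=
  diag_mx (\row_i chi (@mk_set _ _ _ _ _ _ _ m i)).

Lemma mk_iso_mul x : mk_iso m x *m mark_mx = mk_iso m x.
Proof.
apply/rowP => i; rewrite mul_mx_diag !mxE.
apply: cyclic_chi_mul; first exact: mk_measurable.
have : range (mk_iso m) (mk_iso m x) by exists x.
by rewrite mk_image; exact.
Qed.

(** The generators are the preimages of the rows of the projection; with the coordinates of [mk_iso]
    they form a dual basis. *)
Lemma mark_generators : exists gen : 'I_s -> M,
  forall x, comb (mk_iso m x) gen = x.
Proof.
have genP i : exists x, mk_iso m x = row i mark_mx.
  have : range (mk_iso m) (row i mark_mx).
    rewrite mk_image /= => j; rewrite !mxE; case: eqP => [->|_].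
      by exists 1; rewrite mul1r.
    by exists 0; rewrite mul0r.
  by move=> [x _ xE]; exists x.
have [gen genE] := choice genP; exists gen => x.
apply: (@mk_inj _ _ _ _ _ _ _ m); rewrite comb_linear.
rewrite (eq_comb _ (b' := fun i => row i mark_mx))//.
by rewrite /comb -mulmx_sum_row mk_iso_mul.
Qed.

Lemma mark_mx_adj : adj tR mark_mx = mark_mx.
Proof.
apply/matrixP => i j; rewrite !mxE; case: (eqVneq i j) => [->|ij].
  by rewrite !mulr1n /= cstarU invg1 gact_one.
by rewrite !mulr0n raddf0.
Qed.

(** The diagonal entries are self-adjoint idempotents, so the squared norm is the trace, and the
    trace of a characteristic function is the measure of its set. *)
Lemma sqn_mark_mx : (sqn tR mark_mx)%:E = marked_dim m.
Proof.
have E i j : tau tR (mark_mx i j * star tR (mark_mx i j)) =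
    if i == j then Linf_int (Linf_chi mu (@mk_set _ _ _ _ _ _ _ m i)) else 0.
  rewrite !mxE; case: eqVneq => [_|_]; last by rewrite mulr0n mul0r raddf0.
  rewrite mulr1n /= cstarU invg1 gact_one chi_idem; last exact: mk_measurable.
  by rewrite -[LHS]/(ctau (Linf_trace alpha) _) ctauU eqxx mulr1n.
rewrite sqnE -sumEFin; apply: eq_bigr => i _.
under eq_bigr do rewrite E.
rewrite -big_mkcond /= (big_pred1 i) => [|j]; last by rewrite eq_sym.
by case: (Linf_int_chi mu (mk_measurable i)).
Qed.

End Marking.

(* The columns of [a] are those of the boundary [B j] (if [n = j + 1]) and of
   the adjoint of [B n], so that [a *m adj a] is the combinatorial Laplacian. *)
Lemma laplacian_split (rk : nat -> nat) (B : forall k, 'M[ZG G]_(rk k.+1, rk k))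
    n (H : 'M[RR]_(rk n, rk n.+1)) (W : 'M[RR]_(rk n)) :
  from_prev (B := B) W ->
  exists l (a : 'M[ZG G]_(rk n, l)) L Z,
    H *m ibd (A := Linf_gring alpha) (B := B) n + W =
      L *m adj tR (map_mx (@ZG_incl G (Linf_gring alpha)) a) +
      map_mx (@ZG_incl G (Linf_gring alpha)) a *m Z /\
    forall v, @l2_reduced_homology R G rk B n v -> forall w,
      pairing (@complex.Re R \o v) (w *m a *m adj (ZG_tracial R G) a) = 0.
Proof.
set tZ := ZG_tracial R G.
case: n H W => [|j] H W /= prevW.
  exists (rk 1), (adj tZ (B 0)), H, 0; split.
    by rewrite prevW mulmx0 -(map_incl_adj (Linf_trace alpha)) adjK.
  move=> v [_ vB] w; rewrite adjK.
  exact: pairing_boundary.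
have [Z ->] := prevW.
exists (rk j + rk j.+2)%N, (row_mx (B j) (adj tZ (B j.+1))), (row_mx 0 H).
exists (col_mx Z 0); split.
  rewrite map_row_mx -(map_incl_adj (Linf_trace alpha)).
  rewrite mul_row_col mulmx0 addr0; congr (_ + _).
  by rewrite adj_row_mx adjK mul_row_col mul0mx add0r.
move=> v [[_ vcyc] vB] w.
rewrite adj_row_mx adjK mul_mx_row mul_row_col raddfD /=.
by rewrite pairing_cycle// pairing_boundary// addr0.
Qed.

(** The embedding starts from C, while b is computed from another resolution C'; [retract] passes
    from C' through C and D back to C'. In degree n this yields the identity that [spectral_bound]
    takes as input. *)
Lemma l2_betti_spec_le n (C : aug_complex (Ztriv G))
    (D : marked_complex alpha) b :
  resolution C -> embedding C n D -> l2_betti_spec G n b ->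
  (b <= marked_dim (mc_marking D n))%E.
Proof.
move=> exC [f [f_aug f_bd]] [C' [rk [e [B [[exC' _] basis_e bd_e ->]]]]].
have [gen genK] : exists gen : forall k, 'I_(mk_rank (mc_marking D k)) -> D k,
    forall k x, comb (mk_iso (mc_marking D k) x) (gen k) = x.
  pose g k := cid (mark_generators (mc_marking D k)).
  by exists (fun k => projT1 (g k)) => k; exact: projT2 (g k).
have tf : torsion_free (Linf_gring alpha) by exact: Linf_torsion_free.
have [u [Y [H [W [_ _ split1 prevW]]]]] :=
  retract tf exC' basis_e bd_e exC genK f_aug f_bd (leqnn n).
rewrite -sqn_mark_mx lee_fin.
set Phi := (\matrix_i _) in split1.
have PhiE : Phi *m mark_mx (mc_marking D n) = Phi.
  by apply/row_matrixP => i; rewrite row_mul !rowK mk_iso_mul.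
set tZ := ZG_tracial R G.
have Rint1 : itr (Linf_trace alpha) 1 = 1 by exact: Linf_int1.
have [l [a [L [Z [aE Va]]]]] : exists l (a : 'M[ZG G]_(rk n, l)) L Z,
    H *m ibd (A := Linf_gring alpha) (B := B) n + W =
      L *m adj tR (map_mx (@ZG_incl G (Linf_gring alpha)) a) +
      map_mx (@ZG_incl G (Linf_gring alpha)) a *m Z /\
    forall v, @l2_reduced_homology R G rk B n v -> forall w,
      pairing (@complex.Re R \o v) (w *m a *m adj tZ a) = 0.
  exact: laplacian_split.
have [N N0 aN] := boundedP tR
  (adj tR (map_mx (@ZG_incl G (Linf_gring alpha)) a)).
apply: (spectral_bound N0 aN (mark_mx_adj _) PhiE).
  by rewrite split1 -!addrA aE.
(* The lower bound is proved over the group ring, where l2 is available, and carried over by the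
   isometric inclusion. *)
move=> k; rewrite -(map_incl_damp (Linf_trace alpha)) (sqn_map_incl Rint1).
apply: vN_dim_le => // v [] + _.
by case: (n) v => [|j] v //= [].
Qed.

End MarkedModules.

(** * Finitely generated free resolutions *)

Section FreeCover.
Context {S : nzRingType}.

Definition comb_map (M : lmodType S) r (v : 'I_r -> M) (w : 'rV[S]_r) : M :=
  comb w v.
Lemma comb_map_linear (M : lmodType S) r (v : 'I_r -> M) : linear (comb_map v).
Proof. by move=> a x y; rewrite /comb_map combD combZ. Qed.
HB.instance Definition _ (M : lmodType S) r (v : 'I_r -> M) :=
  GRing.isLinear.Build S 'rV[S]_r M *:%R (comb_map v) (@comb_map_linear M r v).

Lemma delta_basis r : is_basis (fun i : 'I_r => delta_mx 0 i : 'rV[S]_r).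
Proof.
split=> [x|s c us c0 i si].
  exists (enum 'I_r), (fun i => x 0 i); rewrite big_enum.
  exact: row_sum_delta.
have /rowP/(_ i) := c0; rewrite summxE mxE (bigD1_seq i)//= big1 ?addr0.
  by rewrite !mxE !eqxx mulr1.
by move=> j /negPf ji; rewrite !mxE eq_sym ji mulr0.
Qed.

Section FreeOn.
Variables (M : lmodType S) (K : choiceType) (v : K -> M).

Definition freeF (k : K) (c : S) : M := c *: v k.
Lemma freeF_zmod k : zmod_morphism (freeF k).
Proof. by move=> a b; rewrite /freeF scalerBl. Qed.
HB.instance Definition _ k :=
  GRing.isZmodMorphism.Build S M (freeF k) (freeF_zmod k).

Definition free_map (x : malg K S) : M := malg_ext freeF x.

Lemma free_map_linear : linear free_map.
Proof.
move=> a x y; rewrite /free_map raddfD /=; congr (_ + _).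
rewrite (malg_extw _ (msuppZ_le a x)) scaler_sumr.
by apply: eq_bigr => k _; rewrite mcoeffZ /freeF scalerA.
Qed.
HB.instance Definition _ :=
  GRing.isLinear.Build S (malg K S) M *:%R free_map free_map_linear.

Lemma malg_basis : is_basis (fun k : K => mkmalgU k (1 : S) : malg K S).
Proof.
split=> [x|s c us c0 k sk].
  exists (msupp x : seq K), (fun k => mcoeff k x).
  rewrite [LHS]monalgE; apply: eq_bigr => k _.
  by apply/malgP => j; rewrite mcoeffZ !mcoeffU mulrnAr mulr1.
have := congr1 (mcoeff k) c0.
rewrite raddf_sum mcoeff0 /= (bigD1_seq k)//= big1.
  by rewrite addr0 mcoeffZ mcoeffUU mulr1.
by move=> j /negPf jk; rewrite mcoeffZ mcoeffU jk mulr0.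
Qed.

End FreeOn.

Definition finite_free (M : lmodType S) : Prop :=
  exists r (e : 'I_r -> M), is_basis e.

Definition fg_pred (M : lmodType S) (Z : M -> Prop) : Prop :=
  exists r (v : 'I_r -> M), (forall i, Z (v i)) /\
    forall x, Z x -> exists c, x = comb c v.

(** The free module is taken on finitely many generators of Z if there are any such, and on all
    elements of Z otherwise; this makes the resolution below finitely generated wherever it can
    be. *)
Lemma free_cover (M : lmodType S) (Z : M -> Prop) :
  Z 0 -> (forall a x y, Z x -> Z y -> Z (a *: x + y)) ->
  exists (N : lmodType S) (g : {linear N -> M}),
    [/\ forall x, Z x <-> exists y, g y = x, free_module N &
        fg_pred Z -> finite_free N].
Proof.
move=> Z0 ZD.
have Zcomb (I : Type) (s : seq I) (c : I -> S) (v : I -> M) :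
    (forall i, Z (v i)) -> Z (\sum_(i <- s) c i *: v i).
  move=> Zv; elim: s => [|i s IHs]; first by rewrite big_nil.
  by rewrite big_cons; exact: ZD.
have [[r [v [vZ gen]]]|nfg] := pselect (fg_pred Z).
  exists 'rV[S]_r, (comb_map v); split.
  - move=> x; split=> [/gen[c ->]|[c <-]]; first by exists c.
    exact: Zcomb.
  - by exists 'I_r, (fun i => delta_mx 0 i); exact: delta_basis.
  - by move=> _; exists r, (fun i => delta_mx 0 i); exact: delta_basis.
pose K : choiceType := {x : M | `[< Z x >]}.
have KZ (k : K) : Z (val k) by exact/asboolP/(valP k).
exists (malg K S), (free_map (val : K -> M)); split=> //.
- move=> x; split=> [Zx|[y <-]]; last exact: (Zcomb _ _ _ val).
  exists (mkmalgU (exist _ x (introT (asboolP (Z x)) Zx) : K) 1).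
  by rewrite /= /free_map malg_extU /= /freeF scale1r.
- by exists K, (fun k => mkmalgU k 1); exact: malg_basis.
Qed.

End FreeCover.

Section StandardResolution.
Context {S : nzRingType} (L : lmodType S).

(** Bundling a map with its source and target lets a resolution be built by iterating one
    function. *)
Record lin_map := LinMap {
  lm_dom : lmodType S;
  lm_cod : lmodType S;
  lm_map :> {linear lm_dom -> lm_cod}
}.

Lemma kernel_cover (f : lin_map) :
  exists (N : lmodType S) (g : {linear N -> lm_dom f}),
    [/\ forall x, f x = 0 <-> exists y, g y = x, free_module N &
        fg_pred (fun x => f x = 0) -> finite_free N].
Proof.
apply: free_cover; first exact: raddf0.
by move=> a x y fx fy; rewrite linearP fx fy scaler0 addr0.
Qed.

Lemma kernel_cover_sig (f : lin_map) :
  {N : lmodType S & {g : {linear N -> lm_dom f} |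
    [/\ forall x, f x = 0 <-> exists y, g y = x, free_module N &
        fg_pred (fun x => f x = 0) -> finite_free N]}}.
Proof. by have [N /cid NP] := cid (kernel_cover f); exists N. Qed.

Definition next_map (f : lin_map) : lin_map :=
  LinMap (projT1 (projT2 (kernel_cover_sig f))).

Lemma next_mapP (f : lin_map) :
  [/\ forall x : lm_dom f, f x = 0 <-> exists y, next_map f y = x,
      free_module (lm_dom (next_map f)) &
      fg_pred (fun x : lm_dom f => f x = 0) ->
      finite_free (lm_dom (next_map f))].
Proof. exact: projT2 (projT2 (kernel_cover_sig f)). Qed.

(** The kernel of the initial zero map is all of L, so entry 1 is the augmentation and entry k + 2
    the boundary onto degree k. *)
Definition map_seq (k : nat) : lin_map :=
  iter k next_map (LinMap (\0 : {linear L -> L})).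

Definition std_bd k : {linear lm_dom (map_seq k.+2) -> lm_dom (map_seq k.+1)} :=
  map_seq k.+2.
Definition std_aug : {linear lm_dom (map_seq 1) -> L} := map_seq 1.

Lemma std_bd_bd k x : std_bd k (std_bd k.+1 x) = 0.
Proof.
have [h _ _] := next_mapP (map_seq k.+2).
by apply/h; exists x.
Qed.

Lemma std_aug_bd x : std_aug (std_bd 0 x) = 0.
Proof. by have [h _ _] := next_mapP (map_seq 1); apply/h; exists x. Qed.

Definition std_cpx : aug_complex L := AugComplex std_bd_bd std_aug_bd.

Lemma std_cpx_resolution : free_resolution std_cpx.
Proof.
split; last by move=> k; have [_ h _] := next_mapP (map_seq k).
split=> [y|x x0|k x x0].
- by have [h _ _] := next_mapP (map_seq 0); exact: (h y).1.
- by have [h _ _] := next_mapP (map_seq 1); exact: (h x).1 x0.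
- by have [h _ _] := next_mapP (map_seq k.+2); exact: (h x).1 x0.
Qed.

Lemma std_cpx_finite0 :
  fg_pred (fun _ : L => True) -> finite_free (std_cpx 0%N).
Proof.
have [_ _ h] := next_mapP (map_seq 0); move=> [r [v [_ gen]]]; apply: h.
by exists r, v; split=> // x _; exact: gen.
Qed.

Lemma std_cpx_finiteS k :
  fg_pred (@is_cycle S L std_cpx k) -> finite_free (std_cpx k.+1).
Proof.
case: k => [|k] fg.
  by have [_ _ h] := next_mapP (map_seq 1); exact: h fg.
by have [_ _ h] := next_mapP (map_seq k.+2); exact: h fg.
Qed.

Lemma std_resolution : exists C : aug_complex L,
  [/\ free_resolution C, fg_pred (fun _ : L => True) -> finite_free (C 0%N) &
      forall k, fg_pred (@is_cycle S L C k) -> finite_free (C k.+1)].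
Proof.
exists std_cpx; split.
- exact: std_cpx_resolution.
- exact: std_cpx_finite0.
- exact: std_cpx_finiteS.
Qed.

End StandardResolution.

(** * Comparison of partial resolutions *)

Section Comparison.
Context {S : nzRingType}.

Lemma basis_map (F M : lmodType S) r (e : 'I_r -> F) (y : 'I_r -> M) :
  is_basis e -> exists h : {linear F -> M}, forall v, h (comb v e) = comb v y.
Proof.
move=> eb; have [co coE] := choice (fun x => is_basis_span x eb).
have co_lin : linear (fun x => comb (co x) y).
  move=> a u v; rewrite -combZ -combD; congr (comb _ _).
  by apply: (is_basis_combI eb); rewrite combD combZ -!coE.
pose hL := GRing.isLinear.Build S F M *:%R (fun x => comb (co x) y) co_lin.
pose h : {linear F -> M} := HB.pack (fun x => comb (co x) y) hL.
exists h => v /=; congr (comb _ _).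
by apply: (is_basis_combI eb); rewrite -coE.
Qed.

Definition covers (F A : lmodType S) (Z : A -> Prop) (q : {linear F -> A}) :=
  forall x, Z x <-> exists y, q y = x.

(* Homotopy equivalence data in one degree between two partial resolutions with
   cycles [Z] and [Z']: [w] is [1 - b a] minus the composite of the previous
   homotopy with the boundary. *)
Definition cycles_comparable (A A' : lmodType S) (Z : A -> Prop)
    (Z' : A' -> Prop) : Prop :=
  exists (a : {linear A -> A'}) (b : {linear A' -> A}) (w : {linear A -> A}),
  [/\ forall x, Z x -> Z' (a x),
      forall x, Z' x -> Z (b x),
      forall x, Z (w x),
      forall x, Z x -> w x = x - b (a x) &
      forall (F : lmodType S) (q : {linear F -> A}), covers Z q ->
        exists h : {linear A -> F}, forall x, q (h x) = w x].

(** A cycle x equals w x + b (a x), and a x lies in the image of p; so the images under w of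
    generators of A and under b of the images of generators of P generate Z. *)
Lemma cycles_comparable_fg (A A' P : lmodType S) (Z : A -> Prop)
    (Z' : A' -> Prop) (p : {linear P -> A'}) :
  cycles_comparable Z Z' -> covers Z' p -> finitely_generated A ->
  finitely_generated P -> fg_pred Z.
Proof.
move=> [a [b [w [aZ bZ wZ wE _]]]] pZ' [r [v gv]] [s [u gu]].
exists (r + s)%N, (fun i => match fintype.split i with
  | inl j => w (v j) | inr j => b (p (u j)) end); split.
  move=> i; case: (fintype.split i) => j; first exact: wZ.
  by apply/bZ/pZ'; exists (u j).
move=> x Zx; have [y yE] := (pZ' _).1 (aZ _ Zx).
have [c cE] := gv x; have [c' c'E] := gu y.
exists (row_mx (\row_i c i) (\row_i c' i)).
have -> : x = w x + b (p y) by rewrite wE// yE subrK.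
rewrite /comb big_split_ord /=; congr (_ + _).
  rewrite cE raddf_sum; apply: eq_bigr => i _ /=.
  rewrite row_mxEl mxE linearZ /=; congr (_ *: _).
  by rewrite -[lshift s i]/(unsplit (inl i)) unsplitK.
rewrite c'E !raddf_sum; apply: eq_bigr => i _ /=.
rewrite row_mxEr mxE !linearZ /=; congr (_ *: _).
by rewrite -[rshift r i]/(unsplit (inr i)) unsplitK.
Qed.

(** [projective_module] lifts through maps onto the whole target, while q is only known to reach the
    values of g. So P is split off a free module of finite rank, and the images of its generators
    are lifted separately. *)
Lemma projective_lift (P F A : lmodType S) (q : {linear F -> A})
    (g : {linear P -> A}) :
  projective_module P -> finitely_generated P ->
  (forall y, exists x, q x = g y) ->
  exists h : {linear P -> F}, forall y, q (h y) = g y.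
Proof.
move=> projP [r [v gv]] gq.
have [sec secE] : exists sec : {linear P -> 'rV[S]_r},
    forall y, comb_map v (sec y) = y.
  apply: (projP _ _ (comb_map v) idfun) => y; have [c ->] := gv y.
  by exists (\row_i c i); apply: eq_bigr => i _; rewrite mxE.
have [x xE] := choice (fun i => gq (v i)).
exists (comb_map x \o sec) => y /=.
rewrite /comb_map comb_linear -[in RHS](secE y) /comb_map comb_linear.
by apply: eq_comb => i /=.
Qed.

Lemma cycles_comparable_step (A A' F P : lmodType S) (Z : A -> Prop)
    (Z' : A' -> Prop) (q : {linear F -> A}) (p : {linear P -> A'}) :
  cycles_comparable Z Z' -> covers Z q -> covers Z' p -> finite_free F ->
  projective_module P -> finitely_generated P ->
  cycles_comparable (fun x => q x = 0) (fun y => p y = 0).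
Proof.
move=> [a [b [w [aZ bZ wZ wE wlift]]]] qZ pZ' [r [e eb]] projP fgP.
have Zq x : Z (q x) by apply/qZ; exists x.
have Zp y : Z' (p y) by apply/pZ'; exists y.
have [y yE] := choice (fun i => (pZ' _).1 (aZ _ (Zq (e i)))).
have [a2 a2E] := basis_map y eb.
have pa2 x : p (a2 x) = a (q x).
  have [v ->] := is_basis_span x eb; rewrite a2E !comb_linear.
  by apply: eq_comb => i /=.
have [b2 b2E] : exists b2 : {linear P -> F}, forall y, q (b2 y) = b (p y).
  apply: (@projective_lift _ _ _ q (b \o p)) => // z /=.
  exact/qZ/bZ/Zp.
have [h hE] := wlift _ _ qZ.
(* Its values lie in the kernel of q because [q (h x) = w x] and w is 1 - b a on Z. *)
pose w2 : {linear F -> F} := (idfun \- (b2 \o a2)) \- (h \o q).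
have w2E x : w2 x = x - b2 (a2 x) - h (q x) by [].
exists a2, b2, w2; split.
- by move=> x qx; rewrite pa2 qx raddf0.
- by move=> z pz; rewrite b2E pz raddf0.
- by move=> x; rewrite w2E !raddfB /= b2E pa2 hE wE// subrr.
- by move=> x qx; rewrite w2E qx raddf0 subr0.
- move=> E g gE.
  have qw2 x : q (w2 x) = 0.
    by rewrite w2E !raddfB /= b2E pa2 hE wE// subrr.
  have [z zE] := choice (fun i => (gE (w2 (e i))).1 (qw2 (e i))).
  have [h2 h2E] := basis_map z eb.
  exists h2 => x; have [v ->] := is_basis_span x eb.
  by rewrite h2E !comb_linear; apply: eq_comb => i /=.
Qed.

End Comparison.

(** * Finite free resolutions of groups of type FP *)

Section FiniteType.
Context {G : groupType}.

Lemma Ztriv_fg : fg_pred (fun _ : Ztriv G => True).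
Proof.
exists 1%N, (fun _ => (1 : int) : Ztriv G); split=> // x _.
exists (const_mx (mkmalgU 1%g (x : int) : ZG G)).
rewrite /comb big_ord1 mxE.
by rewrite [RHS]crossed_actU /= mulr1.
Qed.

Lemma finite_free_fg (S : nzRingType) (M : lmodType S) :
  finite_free M -> finitely_generated M.
Proof.
move=> [r [e eb]]; exists r, e => x.
by have [v ->] := is_basis_span x eb; exists (fun i => v 0 i).
Qed.

Lemma cycles_comparable_id (S : nzRingType) (M : lmodType S) :
  cycles_comparable (fun _ : M => True) (fun _ : M => True).
Proof.
exists idfun, idfun, \0; split=> // [x _|F q _].
  by rewrite /= subrr.
by exists \0 => x; rewrite raddf0.
Qed.

Lemma resolution_covers (S : nzRingType) (L : lmodType S) (D : aug_complex L)
    k :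
  resolution D -> covers (@is_cycle S L D k) (bd D k).
Proof.
move=> exD x; split=> [xc|[y <-]]; last exact: is_cycle_bd.
exact: resolution_exact.
Qed.

(** Finiteness of C k and comparability of its cycles with those of the given projective resolution
    P are carried along together: the cycles of P are generated by the next module, so those of C
    are finitely generated, and the standard resolution then covers them by a finite free module. *)
Lemma type_FP_finite_free m : type_FP G m -> exists C : aug_complex (Ztriv G),
  free_resolution C /\ forall k, (k <= m)%N -> finite_free (C k).
Proof.
move=> [P [exP projP fgP]].
have [C [freeC C0 CS]] := std_resolution (Ztriv G).
exists C; split=> // k km; have [exC _] := freeC.
suff [] : finite_free (C k) /\
    cycles_comparable (@is_cycle _ _ C k) (@is_cycle _ _ P k).
  by [].
elim: k km => [|k IHk] km.
  have F0 := C0 Ztriv_fg.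
  have [augC _ _] := exC; have [augP _ _] := exP.
  split; first exact: F0.
  (* The induction starts in degree -1, where both complexes are the module Z. *)
  have covC : covers (fun _ => True) (aug C) by move=> x; split.
  have covP : covers (fun _ => True) (aug P) by move=> x; split.
  exact: (cycles_comparable_step (cycles_comparable_id _) covC covP F0
    (projP _) (fgP _ km)).
have [Fk cmp] := IHk (ltnW km).
have covC := @resolution_covers _ _ C k exC.
have covP := @resolution_covers _ _ P k exP.
have FS : finite_free (C k.+1).
  apply: CS.
  exact: (cycles_comparable_fg cmp covP (finite_free_fg Fk) (fgP _ km)).
split=> //.
exact: (cycles_comparable_step cmp covC covP FS (projP _) (fgP _ km)).
Qed.

Lemma l2_betti_spec_ex (R : realType) n : type_FP G n.+1 ->
  exists b : \bar R, l2_betti_spec G n b.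
Proof.
move=> /type_FP_finite_free[C [freeC finC]].
have basisP k : exists r, exists e : 'I_r -> C k, (k <= n.+1)%N -> is_basis e.
  have [/finC[r [e eb]]|_] := boolP (k <= n.+1)%N.
    by exists r, e.
  (* Placeholder above degree n + 1, where no basis is required. *)
  by exists 0%N, (fun _ => 0).
have [rk rkP] := choice basisP.
pose e k := projT1 (cid (rkP k)).
have eb k : (k <= n.+1)%N -> is_basis (e k) := projT2 (cid (rkP k)).
have matP k : exists A : 'M[ZG G]_(rk k.+1, rk k),
    (k <= n)%N -> forall i, bd C k (e k.+1 i) = comb (row i A) (e k).
  have [kn|_] := boolP (k <= n)%N; last by exists 0.
  have [A AE] := rows_choice
    (fun i => is_basis_span (bd C k (e k.+1 i)) (eb _ (leqW kn))).
  by exists A.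
pose A k := projT1 (cid (matP k)).
have AE k : (k <= n)%N ->
    forall i, bd C k (e k.+1 i) = comb (row i (A k)) (e k) :=
  projT2 (cid (matP k)).
exists (vN_dim (@l2_reduced_homology R G rk A n))%:E, C, rk, e, A; split=> //.
by move=> k kn i; rewrite AE//; apply: eq_bigr => j _; rewrite mxE.
Qed.

End FiniteType.

Theorem theorem1p3 (R : realType) (n : nat) (G : groupType)
    (hG : type_FP G n.+1)
    (d : measure_display) (X : measurableType d) (mu : probability X R)
    (alpha : standard_action G mu)
    (C : aug_complex (Ztriv G)) (hC : free_resolution C) :
  (l2_betti R G n <= medim alpha C n)%E.
Proof.
apply: le_ereal_inf_tmp => _ [D emb ->].
(* The default value +oo does not occur, since type FP provides a resolution computing the Betti
   number. *)
rewrite /l2_betti; case: xgetP => [b _ bP|nospec].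
  exact: l2_betti_spec_le (proj1 hC) emb bP.
by have [b /nospec] := l2_betti_spec_ex R hG.
Qed.
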